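(* If $\mathbf{A}$ is a finite left nilpotent algebra and $\mathbf{A}^{|A|}$ does not have a nontrivial strongly abelian quotient algebra, then $\mathbf{A}$ is a spread of its type $\mathbf{2}$ minimal sets.
   Context: Left nilpotent: $[1,\dots,[1,[1,1]]\dots]=0$ for a sufficiently long expression in the term condition commutator. Strongly abelian is in the sense of tame congruence theory. Type $\mathbf{2}$ minimal sets are the $\langle\alpha,\beta\rangle$-minimal sets for prime quotients $\alpha\prec\beta$ of $\mathrm{Con}(\mathbf{A})$ of type $\mathbf{2}$. $A$ is a spread of a collection $\mathcal U$ of subsets if $A=p(U_1,\dots,U_k)$ for some polynomial $p$ of $\mathbf{A}$ and (not necessarily distinct) $U_i\in\mathcal U$. *)

(* Defs.v *)
From mathcomp Require Import all_boot all_algebra.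


Unset Printing Implicit Defensive.
Import GRing.Theory.
Local Open Scope ring_scope.

(* Terms with variables in V and constant leaves in C.
   C = Empty_set : terms;  C = T : polynomials (terms with parameters). *)
Inductive term {I : Type} (ar : I -> nat) (C V : Type) : Type :=
| tVar : V -> term ar C V
| tCst : C -> term ar C V
| tApp : forall i : I, ('I_(ar i) -> term ar C V) -> term ar C V.

Fixpoint eval {I : Type} {ar : I -> nat} {T C V : Type}
  (op : forall i : I, ('I_(ar i) -> T) -> T) (c : C -> T) (env : V -> T)
  (t : term ar C V) : T :=
  match t with
  | tVar v => env v
  | tCst k => c k
  | tApp i ts => op i (fun j => eval op c env (ts j))
  end.

Definition no_const {T : Type} (e : Empty_set) : T := match e with end.

Definition teval {I : Type} {ar : I -> nat} {T V : Type}
  (op : forall i : I, ('I_(ar i) -> T) -> T) (env : V -> T)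
  (t : term ar Empty_set V) : T := eval op no_const env t.

Definition join {T : Type} {n m : nat} (a : 'I_n -> T) (c : 'I_m -> T)
  : 'I_n + 'I_m -> T :=
  fun s => match s with inl l => a l | inr l => c l end.

Definition pow_op {I : Type} {ar : I -> nat} (n : nat) {T : Type}
  (op : forall i : I, ('I_(ar i) -> T) -> T) :
  forall i : I, ('I_(ar i) -> {ffun 'I_n -> T}) -> {ffun 'I_n -> T} :=
  fun i args => [ffun j => op i (fun l => args l j)].

Section UA.
Context {I : Type} {ar : I -> nat} {T : Type}
  (op : forall i : I, ('I_(ar i) -> T) -> T).

Definition is_cong (th : T -> T -> Prop) : Prop :=
  (forall x, th x x) /\ (forall x y, th x y -> th y x) /\
  (forall x y z, th x y -> th y z -> th x z) /\
  (forall i (a b : 'I_(ar i) -> T), (forall j, th (a j) (b j)) ->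
     th (op i a) (op i b)).

Definition centralizes (al be de : T -> T -> Prop) : Prop :=
  forall (n m : nat) (t : term ar Empty_set ('I_n + 'I_m))
         (a b : 'I_n -> T) (c d : 'I_m -> T),
    (forall l, al (a l) (b l)) -> (forall l, be (c l) (d l)) ->
    de (teval op (join a c) t) (teval op (join a d) t) ->
    de (teval op (join b c) t) (teval op (join b d) t).

Definition commutator (al be : T -> T -> Prop) : T -> T -> Prop :=
  fun x y => forall de, is_cong de -> centralizes al be de -> de x y.

Definition total_rel : T -> T -> Prop := fun _ _ => True.

Fixpoint lcs (k : nat) : T -> T -> Prop :=
  match k with
  | 0 => total_rel
  | k'.+1 => commutator total_rel (lcs k')
  end.

Definition left_nilpotent : Prop :=
  exists k, forall x y, lcs k x y -> x = y.

(* The quotient algebra A/theta is strongly abelian, written out on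
   representatives: t(x,y) = t(x',y') implies t(z,y) = t(z,y') in A/theta. *)
Definition strongly_abelian_quotient (th : T -> T -> Prop) : Prop :=
  forall (n m : nat) (t : term ar Empty_set ('I_n + 'I_m))
         (x x' z : 'I_n -> T) (y y' : 'I_m -> T),
    th (teval op (join x y) t) (teval op (join x' y') t) ->
    th (teval op (join z y) t) (teval op (join z y') t).

Definition has_nontrivial_sa_quotient : Prop :=
  exists th, is_cong th /\ (exists x y, ~ th x y) /\
             strongly_abelian_quotient th.

Definition poly (k : nat) (p : ('I_k -> T) -> T) : Prop :=
  exists t : term ar T 'I_k, forall x, p x = eval op id x t.

Definition poly1 (f : T -> T) : Prop :=
  exists t : term ar T unit, forall x, f x = eval op id (fun _ => x) t.

Definition incl (al be : T -> T -> Prop) : Prop := forall x y, al x y -> be x y.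

Definition covers (al be : T -> T -> Prop) : Prop :=
  is_cong al /\ is_cong be /\ incl al be /\ (exists x y, be x y /\ ~ al x y) /\
  forall ga, is_cong ga -> incl al ga -> incl ga be -> incl ga al \/ incl be ga.

End UA.

Section TCT.
Context {I : Type} {ar : I -> nat} {T : finType}
  (op : forall i : I, ('I_(ar i) -> T) -> T).

Definition U_set (al be : T -> T -> Prop) (U : {set T}) : Prop :=
  exists f, poly1 op f /\ U = [set f x | x : T] /\
            exists x y, be x y /\ ~ al (f x) (f y).

Definition minimal_set (al be : T -> T -> Prop) (U : {set T}) : Prop :=
  U_set al be U /\ forall V, U_set al be V -> V \subset U -> V = U.

Definition trace (al be : T -> T -> Prop) (U N : {set T}) : Prop :=
  (exists a, a \in U /\ forall x, x \in N <-> (x \in U /\ be a x)) /\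
  exists x y, x \in N /\ y \in N /\ ~ al x y.

Definition preserves (N : {set T}) {k : nat} (p : ('I_k -> T) -> T) : Prop :=
  forall x, (forall i, x i \in N) -> p x \in N.

(* The minimal algebra A|_N / alpha|_N (whose operations are the polynomials
   of A preserving N) is polynomially equivalent to a vector space over a
   finite field: e identifies F^d with N/alpha, and the polynomial operations
   of A|_N/alpha|_N are exactly the affine maps. *)
Definition induced_type2 (al : T -> T -> Prop) (N : {set T}) : Prop :=
  exists (F : finFieldType) (d : nat) (e : 'rV[F]_d -> T),
    (forall v, e v \in N) /\
    (forall x, x \in N -> exists v, al x (e v)) /\
    (forall v w, al (e v) (e w) -> v = w) /\
    (forall k p, poly op k p -> preserves N p ->
       exists (r : 'I_k -> F) (c : 'rV[F]_d), forall v : 'I_k -> 'rV[F]_d,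
         al (p (fun i => e (v i))) (e (\sum_(i < k) r i *: v i + c))) /\
    (forall k (r : 'I_k -> F) (c : 'rV[F]_d), exists p,
       poly op k p /\ preserves N p /\ forall v : 'I_k -> 'rV[F]_d,
         al (p (fun i => e (v i))) (e (\sum_(i < k) r i *: v i + c))).

Definition type2_quotient (al be : T -> T -> Prop) : Prop :=
  exists U N, minimal_set al be U /\ trace al be U N /\ induced_type2 al N.

Definition type2_minimal_set (U : {set T}) : Prop :=
  exists al be, covers op al be /\ type2_quotient al be /\ minimal_set al be U.

Definition spread_of_type2_minimal_sets : Prop :=
  exists (k : nat) (p : ('I_k -> T) -> T) (Us : 'I_k -> {set T}),
    poly op k p /\ (forall i, type2_minimal_set (Us i)) /\
    forall y : T, exists x : 'I_k -> T, (forall i, x i \in Us i) /\ p x = y.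

End TCT.

(* Main.v *)
Require Import Defs.
From HB Require Import structures.
From mathcomp Require Import all_boot all_algebra all_field.
From mathcomp Require Import boolp.

Set Implicit Arguments.
Unset Strict Implicit.

(** Let n = #|A|. In A^n the constants and the tuples with entries in a type 2
    minimal set generate a subalgebra S, and A is a spread of its type 2 minimal
    sets as soon as S contains the tuple enumerating A. Otherwise S lies in a
    maximal proper subalgebra M of A^n. Left nilpotence gives a central chain,
    along which two polynomials t(x, c) and t(x, c') are simultaneously injective
    on any set that the first one maps into itself. This makes M a class of its
    syntactic congruence theta. Let e be an idempotent M-polynomial of minimal
    range among the polynomials that are not constant modulo theta. If no binary
    polynomial with values in the range V of e depends, modulo theta, on both
    variables, then the quotient by theta is strongly abelian. Otherwise V
    carries a quasigroup polynomial, hence a Mal'tsev polynomial d. Any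
    nontrivial coordinate U of V is then an E-minimal set of A with a Mal'tsev
    polynomial, and centrality makes the traces of U affine over a field
    (Wedderburn), so U is a type 2 minimal set. Finally V = e(U^n) is contained
    in M, contradicting the choice of e. *)

(** * Extremal choices and iterated maps on finite sets *)

Lemma min_exists (X : Type) (P : X -> Prop) (m : X -> nat) :
  (exists x, P x) -> exists2 x, P x & forall y, P y -> m x <= m y.
Proof.
case=> x0 Px0.
suff H n x : m x <= n -> P x ->
    exists2 x, P x & forall y, P y -> m x <= m y by exact: (H _ x0 (leqnn _)).
elim: n x => [|n IH] x le_mx Px.
  by exists x => // y _; rewrite (leq_trans le_mx).
case: (pselect (exists2 y, P y & m y < m x)) => [[y Py lt_yx]|min_x].
  by apply: (IH y) => //; rewrite -ltnS (leq_trans lt_yx).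
exists x => // y Py; rewrite leqNgt; apply/negP => lt_yx.
by apply: min_x; exists y.
Qed.

Lemma max_exists (X : Type) (P : X -> Prop) (m : X -> nat) (b : nat) :
  (forall x, P x -> m x <= b) -> (exists x, P x) ->
  exists2 x, P x & forall y, P y -> m y <= m x.
Proof.
move=> bd /(min_exists (fun x => b - m x)) [x Px min_x].
exists x => // y Py; have := min_x y Py.
by rewrite leq_sub2lE // bd.
Qed.

Lemma iter_idem (T : finType) (f : T -> T) :
  exists m, forall x, iter m.+1 f (iter m.+1 f x) = iter m.+1 f x.
Proof.
have [i [p fp]] : exists i p, forall x, iter (p.+1 + i) f x = iter i f x.
  pose F (i : 'I_(#|{ffun T -> T}|.+1)) := [ffun x => iter i f x] : {ffun T -> T}.
  have /injectivePn [i [j nij eqF]] : ~~ injectiveb F.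
    apply/negP => /injectiveP /leq_card; by rewrite card_ord ltnn.
  wlog lt_ij : i j nij eqF / i < j.
    move=> H; case: (ltngtP i j) nij => [lij|lji|/val_inj ->].
    - by move=> nij; apply: (H i j).
    - by move=> nij; apply: (H j i) => //; rewrite eq_sym.
    - by rewrite eqxx.
  exists i, (j - i).-1 => x; rewrite prednK ?subn_gt0 // subnK ?(ltnW lt_ij) //.
  by move/ffunP: eqF => /(_ x); rewrite !ffunE => ->.
have per k q x : i <= k -> iter (q * p.+1 + k) f x = iter k f x.
  move=> le_ik; elim: q => // q IH.
  by rewrite mulSn -addnA -[in LHS](subnK (leq_trans le_ik (leq_addl (q * p.+1) k)))
    addnCA iterD fp -iterD subnK // (leq_trans le_ik) ?leq_addl.
(* This exponent is a multiple of the period [p.+1] exceeding the preperiod [i], so doubling it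
   leaves the iterate unchanged. *)
exists (i.+1 * p.+1).-1 => x; rewrite prednK ?muln_gt0 // -iterD per //.
by rewrite (leq_trans (leqnSn i)) // leq_pmulr.
Qed.

Lemma iter_in (T : Type) (V : T -> Prop) (f : T -> T) n x :
  (forall y, V y -> V (f y)) -> V x -> V (iter n f x).
Proof. by move=> fV Vx; elim: n => //= n; apply: fV. Qed.

Definition inj_on (T : Type) (V : T -> Prop) (f : T -> T) :=
  forall x y, V x -> V y -> f x = f y -> x = y.

Lemma inj_on_iter (T : Type) (V : T -> Prop) (f : T -> T) n :
  (forall x, V x -> V (f x)) -> inj_on V f -> inj_on V (iter n f).
Proof.
move=> fV injf; elim: n => [|n IH] x y Vx Vy //=.
move/injf=> e; apply: IH => //; apply: e; exact: iter_in.
Qed.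

(** An idempotent power of [f] is still injective on [V], hence the identity there. The exponent is
    written [m.+1] so that [iter m f] inverts [f] on [V]. *)
Lemma iter_id_on (T : finType) (V : T -> Prop) (f : T -> T) :
  (forall x, V x -> V (f x)) -> inj_on V f ->
  exists m, forall x, V x -> iter m.+1 f x = x.
Proof.
move=> fV injf; have [m fm] := iter_idem f.
exists m => x Vx; apply: (inj_on_iter (n := m.+1) fV injf) => //.
exact: iter_in.
Qed.

Lemma inj_on_surj (T : finType) (V : T -> Prop) (f : T -> T) y :
  (forall x, V x -> V (f x)) -> inj_on V f -> V y -> exists2 x, V x & f x = y.
Proof.
move=> fV injf Vy; have [m fm] := iter_id_on fV injf.
by exists (iter m f y); [exact: iter_in|exact: fm].
Qed.

(** * Polynomials, twins and the term condition *)

Section Clone.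
Context {I : Type} {ar : I -> nat} {T : Type}.
Variable op : forall i : I, ('I_(ar i) -> T) -> T.

(** The subalgebra of the power T^Y generated by [g]. Polynomials, twins, term-condition matrices
    and the subalgebra S of the power are all instances, so syntactic terms occur only at the
    interface with the definitions. *)
Inductive gen (Y : Type) (g : (Y -> T) -> Prop) : (Y -> T) -> Prop :=
| gen_base f : g f -> gen g f
| gen_op i (F : 'I_(ar i) -> Y -> T) :
    (forall l, gen g (F l)) -> gen g (fun y => op (fun l => F l y)).

Lemma gen_comp (Y Z : Type) (g : (Y -> T) -> Prop) (g' : (Z -> T) -> Prop)
    (psi : Z -> Y) f :
  (forall h, g h -> gen g' (fun z => h (psi z))) ->
  gen g f -> gen g' (fun z => f (psi z)).
Proof.
move=> gg'; elim=> {f} [f /gg' //|i F _ IH].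
exact: (gen_op (F := fun l z => F l (psi z))).
Qed.

Lemma gen_mono (Y : Type) (g g' : (Y -> T) -> Prop) f :
  (forall h, g h -> gen g' h) -> gen g f -> gen g' f.
Proof. exact: (@gen_comp Y Y g g' id). Qed.

(** Parameters are confined to [M]. If [M] is a subalgebra, such polynomials keep [M] invariant;
    taking [M] to be everything gives all polynomials. *)
Definition pol (M : T -> Prop) (Y : Type) (vs : (Y -> T) -> Prop) :=
  gen (fun h => vs h \/ exists2 c, M c & h = fun=> c).

Lemma pol_var M Y (vs : (Y -> T) -> Prop) h : vs h -> pol M vs h.
Proof. by move=> vh; apply: gen_base; left. Qed.

Lemma pol_cst (M : T -> Prop) Y (vs : (Y -> T) -> Prop) c :
  M c -> pol M vs (fun=> c).
Proof. by move=> Mc; apply: gen_base; right; exists c. Qed.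

Lemma pol_comp M Y Z (vs : (Y -> T) -> Prop) (vs' : (Z -> T) -> Prop) psi f :
  (forall h, vs h -> pol M vs' (fun z => h (psi z))) ->
  pol M vs f -> pol M vs' (fun z => f (psi z)).
Proof.
move=> vv'; apply: gen_comp => h [/vv' //|[c Mc ->]]; exact: pol_cst.
Qed.

Lemma pol_sub (M M' : T -> Prop) Y (vs : (Y -> T) -> Prop) f :
  (forall x, M x -> M' x) -> pol M vs f -> pol M' vs f.
Proof.
move=> MM'; apply: gen_mono => h [vh|[c Mc ->]]; first exact: pol_var.
by apply: pol_cst; apply: MM'.
Qed.

Definition pol1 M (f : T -> T) := pol M (fun h => h = id) f.
Definition pol2 M (f : T -> T -> T) :=
  pol M (fun h : T * T -> T => h = fst \/ h = snd) (fun p => f p.1 p.2).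
Definition pol3 M (f : T -> T -> T -> T) :=
  pol M (fun h : T * T * T -> T =>
    [\/ h = fun p => p.1.1, h = fun p => p.1.2 | h = snd])
  (fun p => f p.1.1 p.1.2 p.2).

Lemma pol1_id M : pol1 M id.
Proof. exact: pol_var. Qed.

Lemma pol2_fst M : pol2 M (fun x y => x).
Proof. by apply: pol_var; left. Qed.

Lemma pol2_snd M : pol2 M (fun x y => y).
Proof. by apply: pol_var; right. Qed.

Lemma pol1_comp M Y (vs : (Y -> T) -> Prop) f g :
  pol1 M f -> pol M vs g -> pol M vs (fun y => f (g y)).
Proof. by move=> pf pg; apply: (pol_comp (psi := g)) pf => h ->. Qed.

Lemma pol2_comp M Y (vs : (Y -> T) -> Prop) f g1 g2 :
  pol2 M f -> pol M vs g1 -> pol M vs g2 -> pol M vs (fun y => f (g1 y) (g2 y)).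
Proof.
move=> pf p1 p2; apply: (pol_comp (psi := fun y => (g1 y, g2 y))) pf.
by move=> h [->|->].
Qed.

Lemma pol3_comp M Y (vs : (Y -> T) -> Prop) f g1 g2 g3 :
  pol3 M f -> pol M vs g1 -> pol M vs g2 -> pol M vs g3 ->
  pol M vs (fun y => f (g1 y) (g2 y) (g3 y)).
Proof.
move=> pf p1 p2 p3.
apply: (pol_comp (psi := fun y => (g1 y, g2 y, g3 y))) pf.
by move=> h [->|->|->].
Qed.

Lemma pol1_iter M f n : pol1 M f -> pol1 M (iter n f).
Proof.
move=> pf; elim: n => [|n IH]; first exact: pol1_id.
exact: (pol1_comp pf IH).
Qed.

Lemma pol_closed M Y (vs : (Y -> T) -> Prop) (S : T -> Prop) f y :
  (forall i (a : 'I_(ar i) -> T), (forall l, S (a l)) -> S (op a)) ->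
  (forall h, vs h -> S (h y)) -> (forall x, M x -> S x) ->
  pol M vs f -> S (f y).
Proof.
move=> Sop Svs MS; elim=> {f} [f [/Svs //|[c /MS Sc -> //]]|i F _ IH].
exact: Sop.
Qed.

Lemma pol_cong M Y (vs : (Y -> T) -> Prop) (th : T -> T -> Prop) f y y' :
  is_cong op th -> (forall h, vs h -> th (h y) (h y')) ->
  pol M vs f -> th (f y) (f y').
Proof.
move=> [rf [_ [_ th_op]]] thv; elim=> {f} [f [/thv //|[c _ ->]]|i F _ IH].
  exact: rf.
exact: th_op.
Qed.

Lemma pol1_cong M (th : T -> T -> Prop) f x y :
  is_cong op th -> pol1 M f -> th x y -> th (f x) (f y).
Proof. by move=> cth pf txy; apply: (pol_cong (y := x) cth _ pf) => h ->. Qed.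

(* [F z] ranges over the unary polynomials t(x, c z) of a fixed term t. *)
Definition twin (Z : Type) (F : Z -> T -> T) :=
  gen (fun h : Z * T -> T => (exists c, h = fun p => c p.1) \/ h = snd)
    (fun p => F p.1 p.2).

Lemma twin_id Z : twin (fun (_ : Z) x => x).
Proof. by apply: gen_base; right. Qed.

Lemma twin_comp Z (F G : Z -> T -> T) :
  twin F -> twin G -> twin (fun z x => F z (G z x)).
Proof.
move=> tF tG; apply: (gen_comp (psi := fun p => (p.1, G p.1 p.2))) tF.
move=> h [[c ->]|-> //]; apply: gen_base; left; by exists c.
Qed.

Lemma twin_iter Z (F : Z -> T -> T) n :
  twin F -> twin (fun z => iter n (F z)).
Proof.
move=> tF; elim: n => [|n IH]; first exact: twin_id.
exact: (twin_comp tF IH).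
Qed.

Lemma pol_twin M Y (vs : (Y -> T) -> Prop) Z (psi : Z * T -> Y) f :
  (forall h, vs h ->
    (exists c, forall p, h (psi p) = c p.1) \/ (forall p, h (psi p) = p.2)) ->
  pol M vs f -> twin (fun z x => f (psi (z, x))).
Proof.
move=> vv pf.
suff : gen (fun h : Z * T -> T => (exists c, h = fun p => c p.1) \/ h = snd)
    (fun p => f (psi p)).
  move=> H; rewrite /twin.
  by have -> : (fun p : Z * T => f (psi (p.1, p.2))) = fun p => f (psi p)
    by apply/funext => -[].
apply: gen_comp pf => h [/vv [[c hc]|hs]|[c Mc ->]]; apply: gen_base.
- by left; exists c; apply/funext.
- by right; apply/funext.
- by left; exists (fun=> c).
Qed.

Lemma twin_pol1 M Z f : pol1 M f -> twin (fun _ : Z => f).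
Proof. by apply: (pol_twin (psi := snd)) => h ->; right. Qed.

Lemma twin_at M Z (F : Z -> T -> T) z :
  (forall x, M x) -> twin F -> pol1 M (F z).
Proof.
move=> Mx tF; apply: (gen_comp (psi := fun x => (z, x))) tF => h [[c ->]|->].
  exact: (@pol_cst M T _ (c z)).
exact: pol1_id.
Qed.

Lemma twin_pol2l M f : pol2 M f -> twin (fun y x => f x y).
Proof.
apply: (pol_twin (psi := fun p => (p.2, p.1))) => h [->|->]; first by right.
by left; exists id.
Qed.

Lemma twin_pol2r M f : pol2 M f -> twin f.
Proof.
apply: (pol_twin (psi := fun p => (p.1, p.2))) => h [->|->]; last by right.
by left; exists id.
Qed.

(* The generators of the matrices M(1, be) of the term condition. *)
Definition mat_gen (be : T -> T -> Prop) (h : bool * bool -> T) :=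
  (exists a, h = fun p => a p.1) \/
  (exists2 c, be (c false) (c true) & h = fun p => c p.2).

(** The term condition C(1, be; de), stated on the 2 by 2 matrices that [mat_gen be] generates. *)
Definition central (be de : T -> T -> Prop) := forall h,
  gen (mat_gen be) h ->
  de (h (false, false)) (h (false, true)) -> de (h (true, false)) (h (true, true)).

Definition central_chain (G : nat -> T -> T -> Prop) (K : nat) :=
  [/\ forall x y, G 0 x y, forall x y, G K x y -> x = y,
      forall k, is_cong op (G k) & forall k, central (G k) (G k.+1)].

Lemma central_twin be de Z (F : Z -> T -> T) z z' x y :
  central be de -> twin F -> be x y ->
  de (F z x) (F z y) -> de (F z' x) (F z' y).
Proof.
move=> cen tF bxy.
apply: (cen (fun p => F (if p.1 then z' else z) (if p.2 then y else x))).
apply: (gen_comp (psi := fun p : bool * bool =>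
  (if p.1 then z' else z, if p.2 then y else x))) tF.
move=> h [[c ->]|->]; apply: gen_base; [left|right].
  by exists (fun b : bool => c (if b then z' else z)).
by exists (fun b : bool => if b then y else x).
Qed.

End Clone.

(** If [F z' x = F z' y], then [x] and [y] are related by every [G k], by induction on [k]. The term
    condition transfers the equality to [F z x] and [F z y] modulo [G k.+1]. As [F z] permutes [V],
    one of its powers is the identity on [V], and applying the rest of that power returns to [x] and
    [y]. The set [V] is assumed invariant under [F z] only, not under [F z']. *)
Lemma twin_inj (I : Type) (ar : I -> nat) (T : finType)
    (op : forall i : I, ('I_(ar i) -> T) -> T) G K Z (F : Z -> T -> T) V z z' :
  central_chain op G K -> twin op F -> (forall x, V x -> V (F z x)) ->
  inj_on V (F z) -> inj_on V (F z').
Proof.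
move=> [G0 GK Gc Gcen] tF FV Finj x y Vx Vy eqF; apply: GK.
have [m Fm] := iter_id_on FV Finj.
elim: K => [|k IH]; first exact: G0.
have : G k.+1 (F z x) (F z y).
  apply: (central_twin z (Gcen k) tF IH (_ : G k.+1 (F z' x) (F z' y))).
  by rewrite eqF; case: (Gc k.+1).
move=> GF; rewrite -[x]Fm // -[y]Fm // !iterSr.
have pz : pol1 op (fun=> True) (F z) by exact: twin_at.
exact: (pol1_cong (Gc k.+1) (pol1_iter m pz)).
Qed.

(** * Functions of several variables, changed one coordinate at a time *)

Definition upd (W : eqType) (X : Type) (c : W -> X) (w : W) (s : X) : W -> X :=
  fun v => if v == w then s else c v.

Lemma upd_same (W : eqType) (X : Type) (c : W -> X) w : upd c w (c w) = c.
Proof. by apply/funext => v; rewrite /upd; case: eqP => // ->. Qed.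

Lemma upd_upd (W : eqType) (X : Type) (c : W -> X) w s t :
  upd (upd c w s) w t = upd c w t.
Proof. by apply/funext => v; rewrite /upd; case: eqP. Qed.

Lemma updC (W : eqType) (X : Type) (c : W -> X) v w s t : v != w ->
  upd (upd c v s) w t = upd (upd c w t) v s.
Proof.
move=> vw; apply/funext => u; rewrite /upd.
by case: (eqVneq u w) => // ->; rewrite eq_sym (negbTE vw).
Qed.

Lemma upd_walk (W : finType) (X : Type) (P : (W -> X) -> Prop) a b :
  (forall c w, c w = a w -> P c -> P (upd c w (b w))) -> P a -> P b.
Proof.
move=> step Pa.
pose hyb (s : seq W) w := if w \in s then b w else a w.
have -> : b = hyb (enum W) by apply/funext => w; rewrite /hyb mem_enum.
elim: (enum W) (enum_uniq W) => [|w s IH] /=.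
  by have -> : hyb [::] = a by apply/funext.
case/andP=> ws /IH Ps.
have -> : hyb (w :: s) = upd (hyb s) w (b w).
  by apply/funext => v; rewrite /hyb /upd inE; case: eqP => // ->.
by apply: step => //; rewrite /hyb (negbTE ws).
Qed.

Definition separates (T : Type) (R : T -> T -> Prop) (X : Type) (f : X -> T) :=
  exists x y, ~ R (f x) (f y).

Lemma not_separates (T X : Type) (R : T -> T -> Prop) (f : X -> T) :
  ~ separates R f -> forall x y, R (f x) (f y).
Proof. by move=> nf x y; apply: contrapT => nR; apply: nf; exists x, y. Qed.

(* If G depends on w at the background a, then moving from a to another
   background one coordinate at a time preserves the dependence, for otherwise
   some restriction of G to two coordinates would depend on both of them. *)
Lemma single_dependence (W : finType) (T : Type) (R : T -> T -> Prop)
    (G : (W -> T) -> T) :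
  (forall x y, R x y -> R y x) -> (forall x y z, R x y -> R y z -> R x z) ->
  (forall c v w, v != w ->
    (exists t, separates R (fun s => G (upd (upd c v s) w t))) ->
    (exists s, separates R (fun t => G (upd (upd c v s) w t))) -> False) ->
  forall a b v w, v != w -> separates R (fun s => G (upd a v s)) ->
  forall s t, R (G (upd b w s)) (G (upd b w t)).
Proof.
move=> Rsym Rtr nodep a b v w vw dv.
have : separates R (fun s => G (upd b v s)).
  move: dv; apply: (upd_walk (P := fun c => separates R (fun s => G (upd c v s)))).
  move=> c u _; case: (eqVneq v u) => [->|vu] [x [y nR]].
    by exists x, y; rewrite !upd_upd.
  have indep s t t' : R (G (upd (upd c v s) u t)) (G (upd (upd c v s) u t')).
    move: t t'; apply: not_separates => sep.
    apply: (nodep c v u vu); last by exists s.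
    exists (c u); exists x, y; move: nR.
    by rewrite !(updC _ _ _ vu) upd_same.
  exists x, y => nR'; apply: nR.
  have E s : upd c v s = upd (upd c v s) u (c u) by rewrite updC // upd_same.
  rewrite (E x) (E y); apply: (Rtr _ _ _ (indep x (c u) (b u))).
  apply: (Rtr _ _ _ _ (indep y (b u) (c u))).
  by rewrite !(updC _ _ _ vu).
move=> sep; apply: not_separates => sepw.
apply: (nodep b v w vw); [exists (b w)|exists (b v)].
  case: sep => x [y nR]; exists x, y; move: nR.
  by rewrite !(updC _ _ _ vw) upd_same.
by rewrite upd_same.
Qed.

(** * Syntactic congruences *)

Section Syntactic.
Context {I : Type} {ar : I -> nat} {T : Type}.
Variable op : forall i : I, ('I_(ar i) -> T) -> T.

Definition all_of : T -> Prop := fun=> True.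

(** For an equivalence [R], this is the largest congruence contained in [R]. *)
Definition syn (R : T -> T -> Prop) x y :=
  forall f, pol1 op all_of f -> R (f x) (f y).

Lemma pol1_op_upd M i (c : 'I_(ar i) -> T) j :
  (forall l, M (c l)) -> pol1 op M (fun x => op (upd c j x)).
Proof.
move=> Mc; apply: (gen_op (F := fun l x => upd c j x l)) => l.
rewrite /upd; case: eqP => _; first exact: pol1_id.
exact: (@pol_cst _ _ _ op M T _ (c l)).
Qed.

Lemma syn_cong (R : T -> T -> Prop) :
  (forall x, R x x) -> (forall x y, R x y -> R y x) ->
  (forall x y z, R x y -> R y z -> R x z) -> is_cong op (syn R).
Proof.
move=> Rr Rs Rt; split; [|split; [|split]].
- by move=> x f _.
- by move=> x y H f pf; apply/Rs/H.
- by move=> x y z H H' f pf; apply: Rt (H f pf) (H' f pf).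
move=> i a b ab f pf.
apply: (upd_walk (P := fun c => R (f (op a)) (f (op c)))); last exact: Rr.
move=> c j ca H; apply: Rt H _.
have := ab j _ (pol1_comp pf (pol1_op_upd j (fun l => Logic.I : all_of (c l)))).
by rewrite -ca upd_same.
Qed.

Lemma eval_pol C V (c : C -> T) (t : term ar C V) Y (vs : (Y -> T) -> Prop) env :
  (forall v, pol op all_of vs (fun y => env y v)) ->
  pol op all_of vs (fun y => eval op c (env y) t).
Proof.
move=> pe; elim: t => [v|k|i ts IH] /=; first exact: pe.
  exact: (@pol_cst _ _ _ op all_of Y _ (c k)).
exact: (gen_op (F := fun l y => eval op c (env y) (ts l))).
Qed.

End Syntactic.
Arguments all_of {T}.

(** * Maximal subalgebras *)

Section MaximalSubalgebra.
Context {I : Type} {ar : I -> nat} {T : finType}.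
Variable op : forall i : I, ('I_(ar i) -> T) -> T.
Variables (G : nat -> T -> T -> Prop) (K : nat).
Hypothesis chainG : central_chain op G K.
Variable M : T -> Prop.
Definition subalgebra (S : T -> Prop) :=
  forall i (a : 'I_(ar i) -> T), (forall l, S (a l)) -> S (op a).
Hypothesis M_op : subalgebra M.
Hypothesis M_max : forall S, subalgebra S -> (forall x, M x -> S x) ->
  (exists2 z, S z & ~ M z) -> forall x, S x.
Variables (m0 z0 : T).
Hypotheses (Mm0 : M m0) (nMz0 : ~ M z0).

Local Notation pl1 := (pol1 op all_of).
Local Notation pl2 := (pol2 op all_of).
Local Notation pl3 := (pol3 op all_of).

(** The values at [z] of the unary [M]-polynomials form a subalgebra containing [M] and [z]; by
    maximality it is everything. *)
Lemma generated_by z x : ~ M z -> exists2 h, pol1 op M h & h z = x.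
Proof.
move=> nMz; apply: (M_max (S := fun x => exists2 h, pol1 op M h & h z = x)).
- move=> i a /fin_all_exists2 [F pF Fa].
  exists (fun y => op (fun l => F l y)); first exact: gen_op.
  by congr (op _); apply/funext.
- by move=> y My; exists (fun=> y) => //; apply: pol_cst.
- by exists z => //; exists id => //; apply: pol1_id.
Qed.

(** Each parameter of [f] is replaced by an [M]-polynomial evaluated at [z], and [z] then becomes a
    variable. *)
Lemma pol1_pol2 z f : ~ M z -> pl1 f ->
  exists2 H, pol2 op M H & forall x, f x = H z x.
Proof.
move=> nMz; elim=> {f} [f [->|[c _ ->]]|i F _ /fin_all_exists2 [H pH FH]].
- by exists (fun w x => x) => //; apply: pol2_snd.
- have [h ph hz] := generated_by c nMz.
  by exists (fun w x => h w); [exact: (pol1_comp ph (@pol2_fst _ _ _ op M))|].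
- exists (fun w x => op (fun l => H l w x)).
    exact: (gen_op (F := fun l p => H l p.1 p.2)).
  by move=> x; congr (op _); apply/funext.
Qed.

Lemma pol1_M f x : pol1 op M f -> M x -> M (f x).
Proof. by move=> pf Mx; apply: (pol_closed M_op _ _ pf) => // h ->. Qed.

(* Otherwise z = f x1 lies outside M and f = H z for an M-polynomial H; then
   z is fixed by the M-polynomial H _ x1, hence moved by a permutation that is
   a twin of one of its powers, and the permutation sends z into M. *)
Lemma M_unary_invariant f x0 x1 : pl1 f -> M x0 -> M x1 -> M (f x0) -> M (f x1).
Proof.
move=> pf Mx0 Mx1 Mf0; apply: contrapT => nMz.
set z := f x1 in nMz.
have [H pH fH] := pol1_pol2 nMz pf.
have pHx x : M x -> pol1 op M (H^~ x).
  move=> Mx; apply: (pol2_comp pH); first exact: pol1_id.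
  exact: pol_cst.
pose r := H^~ x1.
have rz : r z = z by rewrite /r -fH.
have [m rm] := iter_idem r.
pose V x := iter m.+1 r x = x.
(* The padding by powers of [r] puts all values into [V], the range of an idempotent power of [r],
   and makes [F x1] the identity on [V]. *)
pose F x w := iter m.+1 r (iter m r (H w x)).
have tF : twin op F.
  apply: (twin_comp (twin_iter _ (twin_pol1 _ (pHx _ Mx1)))).
  apply: (twin_comp (twin_iter _ (twin_pol1 _ (pHx _ Mx1)))).
  exact: (twin_pol2l pH).
have F1 w : F x1 w = iter m.+1 r w by rewrite -[RHS]rm [iter m.+1 r w]iterSr.
have FV x w : V (F x w) by rewrite /V /F rm.
have F1inj : inj_on V (F x1) by move=> a b Va Vb; rewrite !F1 Va Vb.
have F0inj : inj_on V (F x0).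
  by apply: (twin_inj chainG tF _ F1inj) => w _; apply: FV.
have [n Fn] := iter_id_on (fun w _ => FV x0 w) F0inj.
have pr : pol1 op M r := pHx _ Mx1.
have Vz : V z by rewrite /V; elim: m.+1 => //= k ->.
apply: nMz; rewrite -(Fn z Vz) iterSr.
apply: pol1_M.
  apply: pol1_iter; apply: pol1_comp (pol1_iter _ pr) _.
  apply: pol1_comp (pol1_iter _ pr) _; exact: pHx.
by rewrite /F -fH; do 2 apply: pol1_M (pol1_iter _ pr) _.
Qed.

(** The largest congruence for which [M] is a union of classes. *)
Definition theta := syn op (fun x y => M x <-> M y).

Lemma theta_cong : is_cong op theta.
Proof.
apply: syn_cong => [x|x y [h h']|x y z [h h'] [k k']] //; split; auto.
Qed.

Lemma theta_refl x : theta x x. Proof. by case: theta_cong. Qed.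
Lemma theta_sym x y : theta x y -> theta y x.
Proof. by case: theta_cong => _ [s _]; apply: s. Qed.
Lemma theta_trans x y z : theta x y -> theta y z -> theta x z.
Proof. by case: theta_cong => _ [_ [t _]]; apply: t. Qed.

Lemma theta_M x y : M x -> M y -> theta x y.
Proof. by move=> Mx My f pf; split; apply: M_unary_invariant. Qed.

Lemma theta_m0_z0 : ~ theta m0 z0.
Proof. by move/(_ id (@pol1_id _ _ _ op _)) => [H _]; apply/nMz0/H. Qed.

(** The union of the [b]-classes meeting [M] is a subalgebra containing [M]. If it were equal to
    [M], then [M] would be saturated under [b] and [b] would lie below [theta]; so it is
    everything. *)
Lemma cong_meets_M b x : is_cong op b -> ~ (forall x y, b x y -> theta x y) ->
  exists2 m, M m & b x m.
Proof.
move=> cb nb; case: (cb) => [br [bs [bt bo]]].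
apply: (M_max (S := fun x => exists2 m, M m & b x m)).
- move=> i a /fin_all_exists2 [F MF Fa].
  by exists (op F); [apply: M_op|apply: bo].
- by move=> y My; exists y.
apply: contrapT => nS; apply: nb => y y' byy' f pf.
have key u v : b u v -> M (f u) -> M (f v).
  move=> buv Mu; apply: contrapT => nMv; apply: nS; exists (f v) => //.
  by exists (f u) => //; apply: bs; apply: pol1_cong cb pf buv.
by split; apply: key => //; apply: bs.
Qed.

Definition nc (f : T -> T) := separates theta f.

(** Were there no such [h], the syntactic congruence of the kernel of [f] modulo [theta] would
    relate [x] and [y], so it would not lie below [theta]. By [cong_meets_M] every element would
    then be related to one of [M]; since [theta] identifies all elements of [M], the map [f] would
    be constant modulo [theta]. *)
Lemma nc_link f x y : pl1 f -> nc f -> ~ theta x y ->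
  exists2 h, pl1 h & ~ theta (f (h x)) (f (h y)).
Proof.
move=> pf [u [v nf]] nxy; apply: contrapT => nh.
pose b := syn op (fun x y => theta (f x) (f y)).
have cb : is_cong op b.
  apply: syn_cong => [w|w w'|w1 w2 w3]; [exact: theta_refl|exact: theta_sym|].
  exact: theta_trans.
have nb : ~ (forall x y, b x y -> theta x y).
  move/(_ x y) => H; apply: nxy; apply: H => h ph.
  by apply: contrapT => nfh; apply: nh; exists h.
have [m Mm bum] := cong_meets_M u cb nb.
have [m' Mm' bvm] := cong_meets_M v cb nb.
apply: nf; apply: theta_trans (bum id (@pol1_id _ _ _ op _)) _.
apply: theta_trans _ (theta_sym (bvm id (@pol1_id _ _ _ op _))).
exact: pol1_cong theta_cong pf (theta_M Mm Mm').
Qed.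

(** Replacing every parameter of [f] by [m0] yields a twin with parameters in [M]. *)
Lemma twin_M f : pl1 f -> exists F : bool -> T -> T,
  [/\ twin op F, F true = f & pol1 op M (F false)].
Proof.
move=> pf.
suff [F [tF Ff pF]] : exists F : bool -> T -> T,
    [/\ twin op F, forall x, F true x = f x & pol1 op M (F false)].
  by exists F; split=> //; apply/funext.
elim: pf => {f} [f [->|[c _ ->]]|i F _ /fin_all_exists [H FH]].
- by exists (fun _ x => x); split => //; [exact: twin_id|exact: pol1_id].
- exists (fun b _ => if b then c else m0); split => //; last exact: pol_cst.
  by apply: gen_base; left; exists (fun b => if b then c else m0).
exists (fun b x => op (fun l => H l b x)); split.
- by apply: (gen_op (F := fun l p => H l p.1 p.2)) => l; case: (FH l).
- by move=> x; congr (op _); apply/funext => l; case: (FH l).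
- by apply: (gen_op (F := fun l => H l false)) => l; case: (FH l).
Qed.

Definition im_size (f : T -> T) := #|[set f x | x : T]|.

(** Start with [f] of minimal range among all polynomials nonconstant modulo [theta]. A link [h]
    makes [f] after [h] permute the range [V] of [f], and a power [e1] is idempotent with range [V].
    Moving the parameters of [e1] into [M] and iterating to an idempotent gives [e]; twin
    injectivity, used in both directions, keeps [e] nonconstant and its range as small as that of
    [f]. *)
Lemma exists_min_idempotent : exists e, [/\ pol1 op M e,
  forall x, e (e x) = e x, nc e &
  forall f, pl1 f -> nc f -> im_size e <= im_size f].
Proof.
have nc_id : exists f, pl1 f /\ nc f.
  by exists id; split; [exact: pol1_id|exists m0, z0; exact: theta_m0_z0].
have [f [pf ncf] minf] := min_exists im_size nc_id.
have [x0 [y0 nxy]] := ncf.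
have [h ph nfh] := nc_link pf ncf nxy.
pose V v := exists x, v = f x.
pose fh x := f (h x).
have pfh : pl1 fh := pol1_comp pf ph.
have fhV x : V (fh x) by exists (h x).
have fh_inj : inj_on V fh.
  have card_le : #|[set f x | x : T]| <= #|fh @: [set f x | x : T]|.
    have -> : fh @: [set f x | x : T] = [set fh (f x) | x : T].
      by rewrite -imset_comp.
    by apply: minf; split; [exact: pol1_comp pfh pf|exists x0, y0].
  have /imset_injP inj : #|fh @: [set f x | x : T]| == #|[set f x | x : T]|.
    by rewrite eqn_leq leq_imset_card.
  by move=> _ _ [x ->] [y ->]; apply: inj; apply: imset_f.
have [m fhm] := iter_id_on (fun x _ => fhV x) fh_inj.
pose e1 := iter m.+1 fh.
have e1V x : V (e1 x) by exists (h (iter m fh x)).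
have [F [tF F1 pF0]] := twin_M (pol1_iter m.+1 pfh : pl1 e1).
have [n idn] := iter_idem (F false).
have e1n k x : iter k.+1 e1 x = e1 x.
  by elim: k => // k IH; rewrite iterS IH; apply: fhm.
pose E b := iter n.+1 (F b).
have tE : twin op E by exact: twin_iter.
have E1 x : E true x = e1 x by rewrite /E F1 e1n.
pose e := E false.
have pe : pol1 op M e by exact: pol1_iter.
(* From [e1] to [e]: at [true] this family is the identity on [V]. If [e] were constant modulo
   [theta], so would be the resulting permutation of [V]. *)
have e_inj : inj_on V (fun x => e1 (e x)).
  have tw : twin op (fun b x => e1 (E b x)).
    exact: twin_comp (twin_pol1 _ (pol1_iter m.+1 pfh : pl1 e1)) tE.
  apply: (twin_inj chainG tw (z := true)) => [x _|x y Vx Vy]; first exact: e1V.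
  by rewrite !E1 /e1 !fhm.
have [k e1e_id] := iter_id_on (fun x _ => e1V (e x)) e_inj.
(* From [e] back to [e1]: as [e] fixes its own range, [e1] embeds that range into [V], which bounds
   its size. *)
have e1_inj : inj_on (fun x => e x = x) e1.
  move=> x y ex ey; rewrite -!E1.
  apply: (twin_inj chainG tE (V := fun x => e x = x) (z := false)) => //
    [w ew|u v eu ev].
    by rewrite -/e ew.
  by rewrite -/e eu ev.
exists e; split => //.
  apply: contrapT => nsep; have nce := not_separates nsep; apply: nxy.
  have pe1 : pl1 e1 := pol1_iter m.+1 pfh.
  have pe1e : pl1 (fun x => e1 (e x)) by exact: pol1_comp pe1 (pol_sub _ pe).
  have Vf x : V (f x) by exists x.
  rewrite -(e1e_id _ (Vf x0)) -(e1e_id _ (Vf y0)) !iterSr.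
  apply: pol1_cong theta_cong (pol1_iter k pe1e) _.
  exact: pol1_cong theta_cong pe1 (nce _ _).
move=> g pg ncg; apply: leq_trans (minf g (conj pg ncg)).
apply: (@leq_trans #|[set e1 x | x in [set e x | x : T]]|).
  rewrite card_in_imset // => _ _ /imsetP [x _ ->] /imsetP [y _ ->].
  by apply: e1_inj; apply: idn.
apply: subset_leq_card; apply/subsetP => _ /imsetP [x _ ->].
by apply/imsetP; exists (h (iter m fh x)).
Qed.

(** * Operations on the range of a minimal idempotent *)

Section Coordinatize.
Variable e : T -> T.
Hypotheses (pe : pol1 op M e) (idem_e : forall x, e (e x) = e x) (nc_e : nc e).
Hypothesis min_e : forall f, pl1 f -> nc f -> im_size e <= im_size f.

Let V x := e x = x.

Lemma pol_M_all Y (vs : (Y -> T) -> Prop) f : pol op M vs f -> pol op all_of vs f.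
Proof. exact: pol_sub. Qed.

Definition depends_on_both F := [/\ pl2 F, forall x y, V (F x y),
  exists y, separates theta (F^~ y) & exists x, separates theta (F x)].

(** If the quotient by [theta] violates the strongly abelian condition at [t], a link yields
    [g = e (f t)] separating [(z, y)] from [(z, y')]. So [g] depends on a variable of the second
    block, and by [single_dependence] on no variable of the first. Hence [z] may be exchanged for
    [x] and for [x'], and the assumed relation between [t(x, y)] and [t(x', y')] gives a
    contradiction. *)
Lemma no_dependence_sa :
  (forall F, ~ depends_on_both F) -> has_nontrivial_sa_quotient op.
Proof.
move=> nodep; exists theta; split; first exact: theta_cong.
split; first by exists m0, z0; apply: theta_m0_z0.
move=> n m t x x' z y y' eqt; apply: contrapT => nt.
have [f pf] := nc_link (pol_M_all pe) nc_e nt.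
pose g (env : 'I_n + 'I_m -> T) := e (f (teval op env t)).
rewrite -/(g (join z y)) -/(g (join z y')) => ng.
have pg Y (vs : (Y -> T) -> Prop) env :
    (forall v, pol op all_of vs (fun p => env p v)) ->
    pol op all_of vs (fun p => g (env p)).
  move=> pv; apply: pol1_comp (pol_M_all pe) _; apply: pol1_comp pf _.
  exact: eval_pol.
have single a b v w : v != w -> separates theta (fun s => g (upd a v s)) ->
    forall s s', theta (g (upd b w s)) (g (upd b w s')).
  apply: (single_dependence theta_sym theta_trans) => c v' w' vw dv dw.
  apply: (nodep (fun x y => g (upd (upd c v' x) w' y))); split => //.
    apply: (pg _ _ (fun p => upd (upd c v' p.1) w' p.2)) => u; rewrite /upd.
    case: eqP => _; first by apply: pol_var; right.
    case: eqP => _; first by apply: pol_var; left.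
    exact: pol_cst.
  by move=> x1 x2; apply: idem_e.
pose dep j := exists c, separates theta (fun s => g (upd c j s)).
have ndep j : ~ dep j -> forall c s, theta (g c) (g (upd c j s)).
  move=> nd c s; have nc : ~ separates theta (fun s => g (upd c j s)).
    by move=> sep; apply: nd; exists c.
  by have := not_separates nc (c j) s; rewrite upd_same.
have [j dj] : exists j : 'I_m, dep (inr j).
  apply: contrapT => nd; apply: ng.
  apply: (upd_walk (P := fun c => theta (g (join z y)) (g c)) (a := join z y));
    last exact: theta_refl.
  move=> c [i|j] ca H; first by rewrite -[join z y' _]ca upd_same.
  by apply: theta_trans H _; apply: ndep => dj; apply: nd; exists j.
have xz x1 y1 : theta (g (join x1 y1)) (g (join z y1)).
  apply: (upd_walk (P := fun c => theta (g (join x1 y1)) (g c)) (a := join x1 y1));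
    last exact: theta_refl.
  move=> c [i|k] ca H; last by rewrite -[join z y1 _]ca upd_same.
  apply: theta_trans H _; apply: ndep => -[b sep]; case: dj => a sepa.
  by case: sep => s [s' ns]; apply: ns; apply: (single a b _ _ _ sepa).
apply: ng; apply: theta_trans (theta_sym (xz x y)) _.
apply: theta_trans _ (xz x' y').
apply: (pol1_cong theta_cong (pol_M_all pe)).
exact: (pol1_cong theta_cong pf).
Qed.

(** By minimality the range of [f] after [e] is no smaller than that of [e], so [f] loses no point
    of [V]. *)
Lemma nc_comp_e_inj f : pl1 f -> (forall x, V (f x)) ->
  nc (fun x => f (e x)) -> inj_on V f.
Proof.
move=> pf fV ncf.
have /imset_injP inj : #|f @: [set e x | x : T]| == #|[set e x | x : T]|.
  rewrite eqn_leq leq_imset_card -imset_comp.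
  exact: min_e (pol1_comp pf (pol_M_all pe)) ncf.
move=> x y Vx Vy; rewrite -{2}Vx -{2}Vy -{1}Vx -{1}Vy.
by apply: inj; apply: imset_f.
Qed.

(** Links substituted into the two arguments make one column and one row of [F] injective on [V].
    All columns are twins of each other, and so are all rows, so [twin_inj] spreads injectivity to
    the whole table. *)
Lemma dependence_quasigroup F : depends_on_both F ->
  exists H, [/\ pl2 H, forall x y, V (H x y),
    forall y, inj_on V (H^~ y) & forall x, inj_on V (H x)].
Proof.
move=> [pF FV [y0 sepx] [x0 sepy]].
have pe' := pol_M_all pe.
have pF1 y : pl1 (F^~ y).
  by apply: (pol2_comp pF); [exact: pol1_id|exact: pol_cst].
have pF2 x : pl1 (F x).
  by apply: (pol2_comp pF); [exact: pol_cst|exact: pol1_id].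
have [a1 [b1 nab1]] := nc_e.
have [h1 ph1 nh1] := nc_link (pF1 y0) sepx nab1.
have [h2 ph2 nh2] := nc_link (pF2 x0) sepy nab1.
have inj1 : inj_on V (fun x => F (h1 x) y0).
  apply: nc_comp_e_inj => [|x|]; [exact: (pol1_comp (pF1 y0) ph1)|exact: FV|].
  by exists a1, b1.
have inj2 : inj_on V (fun y => F x0 (h2 y)).
  apply: nc_comp_e_inj => [|x|]; [exact: (pol1_comp (pF2 x0) ph2)|exact: FV|].
  by exists a1, b1.
exists (fun x y => F (h1 x) (h2 y)); split => //.
- apply: pol2_comp pF _ _; [apply: pol1_comp ph1 _|apply: pol1_comp ph2 _].
    exact: pol2_fst.
  exact: pol2_snd.
- move=> y; have tF : twin op (fun y x => F (h1 x) y).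
    exact: (twin_comp (twin_pol2l pF) (twin_pol1 _ ph1)).
  exact: (twin_inj (z := y0) chainG tF _ inj1).
move=> x; have tF : twin op (fun x y => F x (h2 y)).
  exact: (twin_comp (twin_pol2r pF) (twin_pol1 _ ph2)).
exact: (twin_inj (z := x0) chainG tF _ inj2).
Qed.

(** If [g] is constant modulo [theta] on [V], then [d x (g x) o] agrees modulo [theta] with
    [d x c o] for [c = g o]. The latter is a twin of [d x o o = x], hence a permutation of [V]; so
    the former is nonconstant modulo [theta] and therefore injective. The alternative later yields
    minimality in a single coordinate. *)
Lemma inj_or_difference_inj d g o : pl3 d -> (forall x y z, V (d x y z)) ->
  (forall x z, V x -> V z -> d x z z = x) ->
  pl1 g -> (forall x, V (g x)) -> V o ->
  inj_on V g \/ inj_on V (fun x => d x (g x) o).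
Proof.
move=> pd dV dxzz pg gV Vo.
have [ncg|ncg] := pselect (nc (fun x => g (e x))).
  by left; apply: nc_comp_e_inj.
have {}ncg := not_separates ncg; right.
pose c := g o.
have pk c' : pl1 (fun x => d x c' o).
  by apply: (pol3_comp pd); [exact: pol1_id|exact: pol_cst|exact: pol_cst].
have tw : twin op (fun c' x => d x c' o).
  apply: (pol_twin (psi := fun p => (p.2, p.1, o))) pd => h [->|->|->].
  - by right.
  - by left; exists id.
  - by left; exists (fun=> o).
have kinj : inj_on V (fun x => d x c o).
  apply: (twin_inj (z := o) chainG tw) => [x _|x y Vx Vy]; first exact: dV.
  by rewrite !dxzz.
have [n kn] := iter_id_on (fun x _ => dV x c o) kinj.
apply: nc_comp_e_inj => //.
  by apply: (pol3_comp pd) => //; [exact: pol1_id|exact: pol_cst].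
apply: contrapT => nsep; have nch := not_separates nsep.
have [x [y nxy]] := nc_e; apply: nxy; rewrite -(kn (e x)) // -(kn (e y)) //.
rewrite !iterSr; apply: pol1_cong theta_cong (pol1_iter n (pk c)) _.
have hk u : theta (d (e u) (g (e u)) o) (d (e u) c o).
  have pk' : pl1 (fun x => d (e u) x o).
    by apply: (pol3_comp pd); [exact: pol_cst|exact: pol1_id|exact: pol_cst].
  apply: (pol1_cong theta_cong pk'); by have := ncg u o; rewrite Vo.
apply: theta_trans (theta_sym (hk x)) _.
exact: theta_trans (nch x y) (hk y).
Qed.

End Coordinatize.
End MaximalSubalgebra.

(** In a quasigroup, [H (x / (y \ y)) (y \ z)] is a Mal'tsev operation. By finiteness both divisions
    are iterated translations, hence polynomials. *)
Lemma quasigroup_maltsev (I : Type) (ar : I -> nat) (T : finType)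
    (op : forall i : I, ('I_(ar i) -> T) -> T) P e H :
  pol1 op P e -> (forall x, e (e x) = e x) -> pol2 op P H ->
  (forall x y, e (H x y) = H x y) ->
  (forall y, inj_on (fun x => e x = x) (H^~ y)) ->
  (forall x, inj_on (fun x => e x = x) (H x)) ->
  exists d, [/\ pol3 op P d, forall x y z, e (d x y z) = d x y z,
    forall x z, e x = x -> e z = z -> d x x z = z &
    forall x z, e x = x -> e z = z -> d x z z = x].
Proof.
move=> pe idem pH HV injl injr; pose V x := e x = x.
have uniform_inverse (F : T -> T -> T) : (forall x y, V (F x y)) ->
    (forall y, inj_on V (F^~ y)) ->
    exists m, forall x y, V x -> iter m.+1 (F^~ y) x = x.
  move=> FV Finj; pose f (p : T * T) := (F p.1 p.2, p.2).
  have itf k x y : iter k f (x, y) = (iter k (F^~ y) x, y).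
    by elim: k => //= k ->.
  have [m fm] : exists m, forall p, V p.1 -> iter m.+1 f p = p.
    apply: iter_id_on => [p _|[x y] [x' y'] /= Vx Vx']; first exact: FV.
    by case=> + eqy; rewrite eqy => /Finj ->.
  by exists m => x y Vx; have := fm (x, y) Vx; rewrite itf => -[].
have [m rK] := uniform_inverse H HV injl.
have [n lK] := uniform_inverse (fun x y => H y x) (fun x y => HV y x) injr.
pose rdiv x y := iter m (H^~ y) x.
pose ldiv x y := iter n (H x) y.
have HrK x y : V x -> H (rdiv x y) y = x by move=> Vx; apply: (rK x y).
have rHK x y : V x -> rdiv (H x y) y = x by move=> Vx; rewrite /rdiv -iterSr rK.
have HlK x y : V y -> H x (ldiv x y) = y by move=> Vy; apply: (lK y x).
have prdiv : pol2 op P rdiv.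
  rewrite /rdiv; elim: m {rK rdiv HrK rHK} => [|k IH]; first exact: pol2_fst.
  by apply: pol2_comp pH IH _; apply: pol2_snd.
have pldiv : pol2 op P ldiv.
  rewrite /ldiv; elim: n {lK ldiv HlK} => [|k IH]; first exact: pol2_snd.
  by apply: pol2_comp pH _ IH; apply: pol2_fst.
exists (fun x y z => H (rdiv (e x) (ldiv (e y) (e y))) (ldiv (e y) (e z))).
split=> [|x y z|x z Vx Vz|x z Vx Vz] //; last 2 first.
- by rewrite Vx Vz -{1}(HlK x x Vx) rHK // HlK.
- by rewrite Vx Vz HrK.
have p1 : pol3 op P (fun x y z => e x).
  by apply: pol1_comp pe _; apply: pol_var; constructor.
have p2 : pol3 op P (fun x y z => e y).
  by apply: pol1_comp pe _; apply: pol_var; constructor.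
have p3 : pol3 op P (fun x y z => e z).
  by apply: pol1_comp pe _; apply: pol_var; constructor.
apply: pol2_comp pH _ _; last exact: pol2_comp.
by apply: pol2_comp prdiv _ _ => //; exact: pol2_comp.
Qed.

(** * The lower central series *)

Section CentralSeries.
Context {I : Type} {ar : I -> nat} {T : finType}.
Variable op : forall i : I, ('I_(ar i) -> T) -> T.

(* T being finite, all environments factor through the #|T * T| pairs of values. *)
Lemma centralizes_central be de : (forall x, be x x) ->
  centralizes op total_rel be de -> central op be de.
Proof.
move=> be_refl cen h gh.
pose N := #|{: T * T}|.
pose a (b : bool) (l : 'I_N) := if b then (enum_val l).2 else (enum_val l).1.
(* For a pair outside [be] the environment repeats the first entry, so reflexivity makes every
   coordinate [be]-related. *)
pose c (b : bool) (l : 'I_N) :=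
  if b && `[< be (enum_val l).1 (enum_val l).2 >]
  then (enum_val l).2 else (enum_val l).1.
have [t ht] : exists t : term ar Empty_set ('I_N + 'I_N),
    forall p, h p = teval op (join (a p.1) (c p.2)) t.
  elim: gh => {h} [_ [[a' ->]|[c' bc ->]]|i F _ /fin_all_exists [t tF]].
  - exists (@tVar _ _ _ _ (inl (enum_rank (a' false, a' true)))).
    by case=> -[] y; rewrite /teval /= /a enum_rankK.
  - exists (@tVar _ _ _ _ (inr (enum_rank (c' false, c' true)))).
    by case=> x -[]; rewrite /teval /= /c enum_rankK //= asboolT.
  exists (@tApp _ _ _ _ _ t) => p; rewrite /teval /=; congr (op _).
  by apply/funext => l; apply: tF.
rewrite !ht /=; apply: cen => // l; rewrite /c /=.
by case: asboolP.
Qed.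

Lemma commutator_cong al be : is_cong op (commutator op al be).
Proof.
split; [|split; [|split]].
- by move=> x de [dr _] _.
- by move=> x y H de cd cen; case: (cd) => _ [ds _]; apply: ds; apply: H.
- move=> x y z H H' de cd cen; case: (cd) => _ [_ [dt _]].
  exact: dt (H de cd cen) (H' de cd cen).
- move=> i a b H de cd cen; case: (cd) => _ [_ [_ dop]].
  by apply: dop => j; apply: H.
Qed.

Lemma commutator_centralizes al be : centralizes op al be (commutator op al be).
Proof.
move=> n m t a b c d ab cd H de cde cen.
exact: cen ab cd (H de cde cen).
Qed.

Lemma lcs_cong k : is_cong op (lcs op k).
Proof. by case: k => [|k]; [repeat split|apply: commutator_cong]. Qed.

Lemma lcs_chain : left_nilpotent op -> exists K, central_chain op (lcs op) K.
Proof.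
move=> [K lK]; exists K; split=> // k; first exact: lcs_cong.
apply: centralizes_central; first by case: (lcs_cong k).
exact: commutator_centralizes.
Qed.

Variable n : nat.

Lemma gen_coord Y (g : (Y -> {ffun 'I_n -> T}) -> Prop) (g' : (Y -> T) -> Prop) j h :
  (forall h, g h -> gen op g' (fun y => h y j)) ->
  gen (pow_op n op) g h -> gen op g' (fun y => h y j).
Proof.
move=> gg'; elim=> {h} [h /gg' //|i F _ IH].
have -> : (fun y => pow_op n op i (fun l => F l y) j) =
    fun y => op (fun l => F l y j) by apply/funext => y; rewrite ffunE.
exact: (gen_op (F := fun l y => F l y j)).
Qed.

Lemma chain_pow G K : central_chain op G K ->
  central_chain (pow_op n op) (fun k f g => forall i, G k (f i) (g i)) K.
Proof.
move=> [G0 GK Gc Gcen]; split.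
- by move=> f g i; apply: G0.
- by move=> f g H; apply/ffunP => i; apply: GK; apply: H.
- move=> k; have [Gr [Gs [Gt Go]]] := Gc k; split; [|split; [|split]].
  + by move=> f i; apply: Gr.
  + by move=> f g H i; apply: Gs; apply: H.
  + by move=> f g h H H' i; apply: Gt (H i) (H' i).
  + by move=> i a b H j; rewrite !ffunE; apply: Go => l; apply: H.
move=> k h gh H j; apply: (Gcen k (fun p => h p j)); last exact: H.
apply: gen_coord gh => f [[a ->]|[c bc ->]]; apply: gen_base.
  by left; exists (fun b => a b j).
by right; exists (fun b => c b j).
Qed.

End CentralSeries.

(** * Finite division rings of endomorphisms *)

Section ScalarField.
Import GRing.Theory.
Local Open Scope ring_scope.

Variables (X : finZmodType) (R : {set {ffun X -> X}}).
Hypothesis R_id : [ffun x => x] \in R.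
Hypothesis R_sub : forall f g, f \in R -> g \in R -> [ffun x => f x - g x] \in R.
Hypothesis R_comp : forall f g, f \in R -> g \in R -> [ffun x => f (g x)] \in R.
Hypothesis R_add : forall f, f \in R -> {morph f : x y / x + y}.
Hypothesis R_inj : forall f, f \in R -> (forall x, f x = 0) \/ injective f.
Hypothesis X_nontrivial : exists x : X, x != 0.

Definition scalar := {f | f \in R}.
HB.instance Definition _ := Finite.on scalar.

Let R_0 : [ffun=> 0] \in R.
Proof.
by have := R_sub R_id R_id; rewrite (_ : finfun _ = [ffun=> 0]) //;
  apply/ffunP => x; rewrite !ffunE subrr.
Qed.

Let R_opp f : f \in R -> [ffun x => - f x] \in R.
Proof.
move=> Rf; have := R_sub R_0 Rf; rewrite (_ : finfun _ = [ffun x => - f x]) //.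
by apply/ffunP => x; rewrite !ffunE sub0r.
Qed.

Let R_plus f g : f \in R -> g \in R -> [ffun x => f x + g x] \in R.
Proof.
move=> Rf Rg; have := R_sub Rf (R_opp Rg).
rewrite (_ : finfun _ = [ffun x => f x + g x]) //.
by apply/ffunP => x; rewrite !ffunE opprK.
Qed.

Let sc0 : scalar := exist (fun f => f \in R) _ R_0.
Let sc1 : scalar := exist (fun f => f \in R) _ R_id.
Let sc_opp (f : scalar) : scalar := exist (fun f => f \in R) _ (R_opp (valP f)).
Let sc_add (f g : scalar) : scalar :=
  exist (fun f => f \in R) _ (R_plus (valP f) (valP g)).
Let sc_mul (f g : scalar) : scalar :=
  exist (fun f => f \in R) _ (R_comp (valP f) (valP g)).

Let scP (f g : scalar) : (forall x, val f x = val g x) -> f = g.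
Proof. by move=> fg; apply/val_inj/ffunP. Qed.

Let sc_addA : associative sc_add.
Proof. by move=> f g h; apply: scP => x; rewrite /= !ffunE addrA. Qed.
Let sc_addC : commutative sc_add.
Proof. by move=> f g; apply: scP => x; rewrite /= !ffunE addrC. Qed.
Let sc_add0 : left_id sc0 sc_add.
Proof. by move=> f; apply: scP => x; rewrite /= !ffunE add0r. Qed.
Let sc_addN : left_inverse sc0 sc_opp sc_add.
Proof. by move=> f; apply: scP => x; rewrite /= !ffunE addNr. Qed.
HB.instance Definition _ := GRing.isZmodule.Build scalar
  sc_addA sc_addC sc_add0 sc_addN.

Let sc_mulA : associative sc_mul.
Proof. by move=> f g h; apply: scP => x; rewrite /= !ffunE. Qed.
Let sc_mul1l : left_id sc1 sc_mul.
Proof. by move=> f; apply: scP => x; rewrite /= !ffunE. Qed.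
Let sc_mul1r : right_id sc1 sc_mul.
Proof. by move=> f; apply: scP => x; rewrite /= !ffunE. Qed.
Let sc_mulDl : left_distributive sc_mul sc_add.
Proof. by move=> f g h; apply: scP => x; rewrite /= !ffunE. Qed.
Let sc_mulDr : right_distributive sc_mul sc_add.
Proof.
move=> f g h; apply: scP => x; rewrite /= !ffunE.
exact: (R_add (valP f)).
Qed.
Let sc_1_neq0 : sc1 != sc0.
Proof.
apply/eqP => /(congr1 (fun f : scalar => val f)) /= /ffunP E.
by case: X_nontrivial => x /eqP; apply; have := E x; rewrite !ffunE.
Qed.
HB.instance Definition _ := GRing.Zmodule_isNzRing.Build scalar
  sc_mulA sc_mul1l sc_mul1r sc_mulDl sc_mulDr sc_1_neq0.
HB.instance Definition _ := FinRing.isNzRing.Build scalar.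

Let scalar_domain : GRing.integral_domain_axiom (scalar : finUnitRingType).
Proof.
move=> f g fg0; have fgx x : val f (val g x) = 0.
  by have /(congr1 (fun f : scalar => val f x)) := fg0; rewrite /= !ffunE.
have [f0|f_inj] := R_inj (valP f).
  by apply/orP; left; apply/eqP/scP => x; rewrite f0 /= ffunE.
apply/orP; right; apply/eqP/scP => x; rewrite /= ffunE.
apply: f_inj; rewrite fgx.
by apply: (addrI (val f 0)); rewrite -(R_add (valP f)) !addr0.
Qed.

(** Wedderburn's little theorem supplies commutativity of composition. *)
Let F : finFieldType := FinDomainFieldType scalar_domain.
Let act (r : F) (x : X) : X := val (r : scalar) x.

Let actD r : {morph act r : x y / x + y}.
Proof. exact: (R_add (valP (r : scalar))). Qed.
Let actDl r s x : act (r + s) x = act r x + act s x.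
Proof. by rewrite /act /= ffunE. Qed.
Let actM r s x : act (r * s) x = act r (act s x).
Proof. by rewrite /act /= ffunE. Qed.
Let act1 x : act 1 x = x.
Proof. by rewrite /act /= ffunE. Qed.
Let act0 x : act 0 x = 0.
Proof. by rewrite /act /= ffunE. Qed.

Definition linear_embedding (d : nat) (e : 'rV[F]_d -> X) :=
  [/\ injective e, {morph e : v w / v + w} &
      forall r v, e (r *: v) = act r (e v)].

Let embedding0 d (e : 'rV[F]_d -> X) : linear_embedding e -> e 0 = 0.
Proof. by move=> [_ eD _]; apply: (addrI (e 0)); rewrite -eD !addr0. Qed.

Lemma extend_embedding d (e : 'rV[F]_d -> X) x : linear_embedding e ->
  (forall v, e v <> x) -> exists e' : 'rV[F]_(1 + d) -> X, linear_embedding e'.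
Proof.
move=> le nx; have [e_inj eD eZ] := le.
pose e' (v : 'rV[F]_(1 + d)) := act (v 0 0) x + e (rsubmx v).
have e'D : {morph e' : v w / v + w}.
  move=> v w; rewrite /e' mxE actDl linearD eD /=.
  by rewrite -!addrA; congr (_ + _); rewrite addrCA.
have e'Z r v : e' (r *: v) = act r (e' v).
  by rewrite /e' mxE linearZ /= eZ actD actM.
exists e'; split => // v w evw.
have {evw} : e' (v - w) = 0.
  by apply: (addIr (e' w)); rewrite -e'D subrK add0r.
set u := v - w => eu; apply: subr0_eq; rewrite -/u.
have u0 : u 0 0 = 0.
  have [//|nz] := eqVneq (u 0 0) 0; case: (nx ((u 0 0)^-1 *: - rsubmx u)).
  rewrite eZ -[RHS]act1 -(mulVf nz) actM; congr (act _ _).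
  apply: (addIr (e (rsubmx u))); rewrite -eD addNr (embedding0 le).
  exact: esym.
move: eu; rewrite /e' u0 act0 add0r -(embedding0 le) => /e_inj ru.
apply/rowP => i; rewrite [RHS]mxE; case: (split_ordP i) => j ->.
  by rewrite (ord1 j) -[RHS]u0; congr (u _ _); apply: val_inj.
by have /rowP /(_ j) := ru; rewrite !mxE.
Qed.

(** An embedding of maximal dimension is onto, since otherwise it could be extended. The dimension
    is bounded because [d] is less than the number of row vectors, which is at most [#|X|]. *)
Lemma scalar_coordinates : exists (F : finFieldType) (d : nat) (e : 'rV[F]_d -> X),
  [/\ injective e, forall x, exists v, e v = x, {morph e : v w / v + w},
      forall r, exists2 f, f \in R & forall v, e (r *: v) = f (e v) &
      forall f, f \in R -> exists r, forall v, e (r *: v) = f (e v)].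
Proof.
pose embedding := {d : nat & 'rV[F]_d -> X}.
have [[d e] /= le maxe] : exists2 de : embedding,
    linear_embedding (projT2 de) &
    forall de' : embedding, linear_embedding (projT2 de') ->
      (projT1 de' <= projT1 de)%N.
  apply: (@max_exists _ _ _ #|X|).
    move=> [d e] /= [/leq_card + _ _]; rewrite card_mx mul1n.
    apply: leq_trans; apply: ltnW; apply: ltn_expl.
    exact: finNzRing_gt1.
  exists (existT _ 0%N (fun=> 0)); split => [v w _||r v] /=.
  - by rewrite !thinmx0.
  - by move=> v w; rewrite addr0.
  - by apply: (addrI (act r 0)); rewrite -actD !addr0.
have [e_inj eD eZ] := le.
exists F, d, e; split => //.
- move=> x; apply: contrapT => nx.
  have [v ev|e' le'] := extend_embedding le (x := x); first by apply: nx; exists v.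
  by have := maxe (existT _ _ e') le'; rewrite /= ltnn.
- by move=> r; exists (val (r : scalar)); [exact: valP|exact: eZ].
- by move=> f Rf; exists (exist _ f Rf : scalar) => v; rewrite eZ.
Qed.

End ScalarField.

(** * Passage between syntactic terms and generated functions *)

Section TermConversion.
Context {I : Type} {ar : I -> nat} {T : Type}.
Variable op : forall i : I, ('I_(ar i) -> T) -> T.

Lemma pol_term V Y (env : Y -> V -> T) (vs : (Y -> T) -> Prop) f :
  (forall h, vs h -> exists v, h = env^~ v) -> pol op all_of vs f ->
  exists t : term ar T V, forall y, f y = eval op id (env y) t.
Proof.
move=> hv; elim=> {f} [f [/hv [v ->]|[c _ ->]]|i F _ /fin_all_exists [t tF]].
- by exists (@tVar _ _ _ _ v).
- by exists (@tCst _ _ _ _ c).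
by exists (@tApp _ _ _ _ _ t) => y /=; congr (op _); apply/funext => l; apply: tF.
Qed.

Lemma poly1_pol1 f : poly1 op f <-> pol1 op all_of f.
Proof.
split=> [[t ft]|pf].
  rewrite (funext ft) /pol1; apply: eval_pol => v; exact: pol1_id.
by apply: (pol_term (env := fun x _ => x) _ pf) => h ->; exists tt.
Qed.

Definition polW W := pol op all_of (fun h : (W -> T) -> T => exists w, h = @^~ w).

Lemma poly_polW k (p : ('I_k -> T) -> T) : Defs.poly op k p <-> polW p.
Proof.
split=> [[t pt]|pp]; last exact: (pol_term (env := id) _ pp).
by rewrite (funext pt); apply: eval_pol => v; apply: pol_var; exists v.
Qed.

Lemma pol_gen Y Z (vs : (Y -> T) -> Prop) (g : (Z -> T) -> Prop) psi f :
  (forall c, g (fun=> c)) -> (forall h, vs h -> gen op g (fun z => h (psi z))) ->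
  pol op all_of vs f -> gen op g (fun z => f (psi z)).
Proof.
move=> gc gv; apply: gen_comp => h [/gv //|[c _ ->]].
exact: (gen_base op (gc c)).
Qed.

Lemma pol3_gen Z (g : (Z -> T) -> Prop) d h1 h2 h3 :
  (forall c, g (fun=> c)) -> pol3 op all_of d ->
  gen op g h1 -> gen op g h2 -> gen op g h3 ->
  gen op g (fun z => d (h1 z) (h2 z) (h3 z)).
Proof.
move=> gc pd g1 g2 g3.
apply: (pol_gen (psi := fun z => (h1 z, h2 z, h3 z)) gc _ pd).
by move=> h [->|->|->].
Qed.

End TermConversion.

(** * E-minimal sets with a Mal'tsev polynomial *)

Section Type2.
Context {I : Type} {ar : I -> nat} {T : finType}.
Variable op : forall i : I, ('I_(ar i) -> T) -> T.
Variables (G : nat -> T -> T -> Prop) (K : nat).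
Hypothesis chainG : central_chain op G K.
Variables (e : T -> T) (d : T -> T -> T -> T).
Hypotheses (pe : pol1 op all_of e) (idem_e : forall x, e (e x) = e x).
Hypotheses (pd : pol3 op all_of d) (dU : forall x y z, e (d x y z) = d x y z).
Hypothesis dxxz : forall x z, e x = x -> e z = z -> d x x z = z.
Hypothesis dxzz : forall x z, e x = x -> e z = z -> d x z z = x.
Hypothesis e_minimal : forall f, pol1 op all_of f ->
  (forall x, e (f x) = f x) -> (forall x, f (f x) = f x) ->
  (exists x y, f x <> f y) -> forall u, e u = u -> f u = u.
Hypothesis e_nonconst : exists x y, e x <> e y.

Local Notation pl1 := (pol1 op all_of).

Definition trivial_on_U (R : T -> T -> Prop) :=
  forall x y, e x = x -> e y = y -> R x y -> x = y.

Definition rel_size (R : T -> T -> Prop) :=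
  #|[set p : T * T | `[< R p.1 p.2 >]]|.

Lemma incl_size (R S : T -> T -> Prop) :
  incl R S -> rel_size S <= rel_size R -> incl S R.
Proof.
move=> RS le x y Sxy.
have sub : [set p : T * T | `[< R p.1 p.2 >]] \subset [set p | `[< S p.1 p.2 >]].
  by apply/subsetP => p; rewrite !inE => /asboolP /RS H; apply/asboolP.
have /eqP /setP /(_ (x, y)) : [set p : T * T | `[< R p.1 p.2 >]] ==
  [set p | `[< S p.1 p.2 >]] by rewrite eqEcard sub.
by rewrite !inE /= (asboolT Sxy) => /asboolP.
Qed.

Lemma rel_size_le (R : T -> T -> Prop) : rel_size R <= #|{: T * T}|.
Proof. exact: max_card. Qed.

(** The least level that is trivial on U is positive, because [G 0] is total and [e] is not
    constant. *)
Lemma exists_level : exists k, ~ trivial_on_U (G k) /\ trivial_on_U (G k.+1).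
Proof.
have [G0 GK Gc Gcen] := chainG.
have [k triv mink] : exists2 k, trivial_on_U (G k) &
    forall j, trivial_on_U (G j) -> k <= j.
  by apply: (min_exists id); exists K => x y _ _; apply: GK.
case: k => [|k] in triv mink *.
  case: e_nonconst => x [y]; case; exact: triv.
by exists k; split=> // /mink; rewrite ltnn.
Qed.

Section Level.
Variable k : nat.
Hypothesis Gk1 : trivial_on_U (G k.+1).

(** Take [be] minimal among the congruences below [G k] that are nontrivial on U, and [al] maximal
    among those properly below [be]. Minimality of [be] forces [al] to be trivial on U. *)
Lemma exists_quotient : ~ trivial_on_U (G k) -> exists al be,
  [/\ covers op al be, trivial_on_U al, ~ trivial_on_U be & incl be (G k)].
Proof.
have [_ _ Gc _] := chainG.
move=> nGk.
pose P be := [/\ is_cong op be, incl be (G k) & ~ trivial_on_U be].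
have [be [cbe beG nbe] minbe] : exists2 be, P be &
    forall b, P b -> rel_size be <= rel_size b.
  by apply: min_exists; exists (G k); split.
pose Q al := [/\ is_cong op al, incl al be & ~ incl be al].
have [al [cal albe nal] maxal] : exists2 al, Q al &
    forall a, Q a -> rel_size a <= rel_size al.
  apply: (max_exists (fun R _ => rel_size_le R)).
  exists eq; split.
  - split; [by []|split; [by move=> x y ->|split]].
      by move=> x y z -> ->.
    by move=> i a b /funext ->.
  - by case: cbe => r _ x y ->.
  - by move=> H; apply: nbe => x y _ _; apply: H.
exists al, be; split => //.
- split=> //; split=> //; split=> //; split.
    apply: contrapT => H; apply: nal => x y bxy.
    by apply: contrapT => nxy; apply: H; exists x, y.
  move=> ga cga alga gabe; have [bg|nbg] := pselect (incl be ga); first by right.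
  by left; apply: incl_size => //; apply: maxal.
- apply: contrapT => ntal; apply: nal; apply: incl_size => //.
  by apply: minbe; split=> // x y /albe /beG.
Qed.

Variables al be : T -> T -> Prop.
Hypotheses (cov : covers op al be) (trivial_al : trivial_on_U al).
Hypotheses (nontriv_be : ~ trivial_on_U be) (be_G : incl be (G k)).

Let cal : is_cong op al. Proof. by case: cov. Qed.
Let cbe : is_cong op be. Proof. by case: cov => _ []. Qed.

(** Otherwise intersect [be] with the syntactic congruence of the kernel of [g] modulo [al]. The
    result lies between [al] and [be] and contains the pair [(g x, g y)], so it is not [al]; it
    cannot be [be] either, as it would then contain [(x, y)]. *)
Lemma cover_link g x y : pl1 g -> be x y -> ~ al (g x) (g y) ->
  exists2 h, pl1 h & ~ al (g (h (g x))) (g (h (g y))).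
Proof.
move=> pg bxy nxy; apply: contrapT => nh.
have [ar_ [as_ [at_ _]]] := cal; have [br [bs [bt bo]]] := cbe.
pose s := syn op (fun u v => al (g u) (g v)).
have [sr [ss [st so]]] : is_cong op s.
  by apply: syn_cong => [u|u v|u v w]; [exact: ar_|exact: as_|exact: at_].
pose b u v := be u v /\ s u v.
have cb : is_cong op b.
  split; [|split; [|split]].
  - by move=> u; split.
  - by move=> u v [/bs ? /ss ?].
  - by move=> u v w [h1 h2] [h3 h4]; split; [apply: bt h1 h3|apply: st h2 h4].
  - by move=> i a c H; split; [apply: bo|apply: so] => j; case: (H j).
have [_ [_ [ab [_ cover]]]] := cov.
have alb : incl al b.
  move=> u v auv; split; first exact: ab.
  by move=> h ph; apply: (pol1_cong cal (pol1_comp pg ph)).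
have bbe : incl b be by move=> u v [].
have [ba|bb] := cover b cb alb bbe.
- apply: nxy; apply: ba; split; first exact: (pol1_cong cbe pg).
  by move=> h ph; apply: contrapT => nal; apply: nh; exists h.
- by apply: nxy; have [_ /(_ id (@pol1_id _ _ _ op _))] := bb _ _ bxy.
Qed.

(** Passes from idempotent minimality to minimality for the quotient. A separating [g] of least
    range inside that of [f] has, by [cover_link], a composite permuting its range. A power of this
    composite is a nonconstant idempotent into U, so it fixes U pointwise, and its values are values
    of [f]. *)
Lemma onto_U f : pl1 f -> (forall x, e (f x) = f x) ->
  (exists x y, be x y /\ ~ al (f x) (f y)) -> forall u, e u = u -> exists x, f x = u.
Proof.
move=> pf fU [x0 [y0 [bxy0 nxy0]]].
pose P g := [/\ pl1 g, forall x, exists y, g x = f y &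
  exists x y, be x y /\ ~ al (g x) (g y)].
have [g [pg gf [x [y [bxy nxy]]]] ming] : exists2 g, P g &
    forall g', P g' -> im_size g <= im_size g'.
  by apply: min_exists; exists f; split=> // [x|]; [exists x|exists x0, y0].
have [h ph nh] := cover_link pg bxy nxy.
pose gh z := g (h z).
have pgh : pl1 gh := pol1_comp pg ph.
pose V v := exists x, v = g x.
have ghV z : V (gh z) by exists (h z).
have gh_inj : inj_on V gh.
  have /imset_injP inj : #|gh @: [set g x | x : T]| == #|[set g x | x : T]|.
    rewrite eqn_leq leq_imset_card -imset_comp.
    apply: ming; split; first exact: pol1_comp pgh pg.
      by move=> z; apply: gf.
    by exists x, y.
  by move=> _ _ [u ->] [v ->]; apply: inj; apply: imset_f.
have [m ghm] := iter_id_on (fun z _ => ghV z) gh_inj.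
have fixU := e_minimal (pol1_iter m.+1 pgh).
move=> u Uu; have [z gz] := gf (h (iter m gh u)).
exists z; rewrite -gz; apply: fixU => //.
- by move=> v; have [w E] := gf (h (iter m gh v)); rewrite iterS /gh E.
- by move=> v; apply: ghm; apply: ghV.
exists (g x), (g y); rewrite !ghm; [|by exists y|by exists x].
by move=> E; apply: nxy; rewrite E; case: cal.
Qed.

Definition U := [set x | e x == x].

Lemma inU x : (x \in U) <-> e x = x.
Proof. by rewrite inE; split=> /eqP. Qed.

Lemma U_minimal : minimal_set op al be U.
Proof.
split.
  exists e; split; first exact/poly1_pol1.
  split.
    apply/setP => x; rewrite inE; apply/eqP/imsetP => [<-|[y _ ->] //].
    by exists x.
  apply: contrapT => nxy; apply: nontriv_be => x y Ux Uy bxy.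
  apply: trivial_al => //; apply: contrapT => nal; apply: nxy.
  by exists x, y; rewrite Ux Uy.
move=> V [f [/poly1_pol1 pf [-> sep]]] fU.
apply/eqP; rewrite eqEsubset fU; apply/subsetP => u /inU Uu.
have [||x <-] := @onto_U f pf _ _ u Uu => //; last exact: imset_f.
by move=> x; apply/inU/(subsetP fU)/imset_f.
Qed.

(** Since [G k.+1] is trivial on U, centrality becomes an exact term condition for U-valued
    functions. *)
Lemma term_condition h : gen op (mat_gen be) h -> (forall p, e (h p) = h p) ->
  h (false, false) = h (false, true) -> h (true, false) = h (true, true).
Proof.
have [_ _ Gc Gcen] := chainG.
move=> gh hU h00; apply: Gk1 => //; apply: (Gcen k); last first.
  by rewrite h00; case: (Gc k.+1).
apply: gen_mono gh => f [[a ->]|[c bc ->]]; apply: gen_base.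
  by left; exists a.
by right; exists c => //; apply: be_G.
Qed.

(** The maps sending [z] to [d z v u] are twins, and [v = u] gives the identity on U; so all are
    injective there. The hypothesis reads [d x y u = d y y u]. *)
Lemma d_cancel x y u : e x = x -> e y = y -> e u = u -> d x y u = u -> x = y.
Proof.
move=> Ux Uy Uu; rewrite -{2}(dxxz Uy Uu) => E.
have tw : twin op (fun v z => d z v u).
  apply: (pol_twin (psi := fun p => (p.2, p.1, u))) pd => h [->|->|->].
  - by right.
  - by left; exists id.
  - by left; exists (fun=> u).
have dU' z : e z = z -> e (d z u u) = d z u u by move=> _; apply: dU.
apply: (twin_inj chainG tw dU') Ux Uy E => z w Uz Uw.
by rewrite !dxzz.
Qed.

(* R x y z = d (p (d x y z)) (d (p x) (p y) (p z)) (p y) equals p y when x = y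
   or y = z; the term condition transfers R y y y = R y y z to
   R x y y = R x y z. *)
Lemma pol_commutes_d W (p : (W -> T) -> T) x y z :
  polW op p -> (forall v, e (p v) = p v) ->
  (forall w, e (x w) = x w) -> (forall w, e (y w) = y w) ->
  (forall w, e (z w) = z w) -> (forall w, be (y w) (z w)) ->
  p (fun w => d (x w) (y w) (z w)) = d (p x) (p y) (p z).
Proof.
move=> pp pU Ux Uy Uz byz.
pose R (x y z : W -> T) :=
  d (p (fun w => d (x w) (y w) (z w))) (d (p x) (p y) (p z)) (p y).
have Ryz z' : (forall w, e (z' w) = z' w) -> R y y z' = p y.
  move=> Uz'; rewrite /R (_ : (fun w => _) = z'); last first.
    by apply/funext => w; apply: dxxz.
  by rewrite (dxxz (pU y) (pU z')) dxxz.
have Rxy : R x y y = p y.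
  rewrite /R (_ : (fun w => _) = x); last by apply/funext => w; apply: dxzz.
  by rewrite (dxzz (pU x) (pU y)) dxxz.
have Rxz : R x y z = p y.
  rewrite -[RHS]Rxy; apply: esym.
  pose X (b : bool) := if b then x else y.
  pose Z (b : bool) := if b then z else y.
  apply: (term_condition (h := fun q => R (X q.1) y (Z q.2))).
  - have gc c : mat_gen be (fun=> c : T) by left; exists (fun=> c).
    have gX w : gen op (mat_gen be) (fun q => X q.1 w).
      by apply: gen_base; left; exists (fun b => X b w).
    have gZ w : gen op (mat_gen be) (fun q => Z q.2 w).
      by apply: gen_base; right; exists (fun b => Z b w) => //=.
    have gy c : gen op (mat_gen be) (fun=> c) by apply: gen_base.
    have gp v : (forall w, gen op (mat_gen be) (fun q => v q w)) ->
        gen op (mat_gen be) (fun q => p (v q)).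
      by move=> gv; apply: (pol_gen gc _ pp) => h [w ->].
    apply: (pol3_gen gc pd); last exact: gy.
      by apply: gp => w; apply: (pol3_gen gc pd).
    by apply: (pol3_gen gc pd) => //; apply: gp.
  - by move=> q; apply: dU.
  by rewrite /= !Ryz.
by apply: d_cancel Rxz.
Qed.

(** * The vector space structure on a trace *)

Section Trace.
Import GRing.Theory.
Local Open Scope ring_scope.
Variables o v0 : T.
Hypotheses (Uo : e o = o) (Uv0 : e v0 = v0) (bov0 : be o v0) (nov0 : o <> v0).

Definition inN x := (e x == x) && `[< be o x >].

Let inN_U x : inN x -> e x = x. Proof. by case/andP => /eqP. Qed.
Let inN_be x : inN x -> be o x. Proof. by case/andP => _ /asboolP. Qed.
Let inNP x : e x = x -> be o x -> inN x.
Proof. by move=> /eqP Ux box; apply/andP; split => //; apply/asboolP. Qed.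
Let inN_be2 x y : inN x -> inN y -> be x y.
Proof.
by move=> /inN_be bx /inN_be by_; case: cbe => _ [bs [bt _]]; apply: bt (bs _ _ bx) by_.
Qed.
Let inN_o : inN o. Proof. by apply: inNP => //; case: cbe. Qed.

Let inN_d x y z : inN x -> inN y -> inN z -> inN (d x y z).
Proof.
move=> Nx Ny Nz; apply: inNP => //.
rewrite -{1}(dxxz Uo Uo); apply: (pol_cong (y := (o, o, o)) (y' := (x, y, z)) cbe _ pd).
by move=> h [->|->|->]; apply: inN_be.
Qed.

(** [d] commutes with itself on the trace, as the instance of [pol_commutes_d] in which the
    polynomial is [d]. *)
Let entropic x1 y1 z1 x2 y2 z2 x3 y3 z3 :
  inN x1 -> inN y1 -> inN z1 -> inN x2 -> inN y2 -> inN z2 ->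
  inN x3 -> inN y3 -> inN z3 ->
  d (d x1 y1 z1) (d x2 y2 z2) (d x3 y3 z3) =
  d (d x1 x2 x3) (d y1 y2 y3) (d z1 z2 z3).
Proof.
move=> Nx1 Ny1 Nz1 Nx2 Ny2 Nz2 Nx3 Ny3 Nz3.
pose env a b c (w : nat) : T := if w is w'.+1 then if w' is _.+1 then c else b else a.
apply: (@pol_commutes_d nat (fun v => d (v 0%N) (v 1%N) (v 2%N))
  (env x1 x2 x3) (env y1 y2 y3) (env z1 z2 z3)).
- by apply: pol3_comp pd _ _ _; apply: pol_var; eexists.
- by move=> v; apply: dU.
- by case=> [|[|w]]; apply: inN_U.
- by case=> [|[|w]]; apply: inN_U.
- by case=> [|[|w]]; apply: inN_U.
- by case=> [|[|w]]; apply: inN_be2.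
Qed.

Definition trace_type := {x : T | inN x}.
HB.instance Definition _ := Finite.on trace_type.
Local Notation X := trace_type.
Implicit Types x y : X.

Let NP x : inN (val x). Proof. exact: valP. Qed.
Let NU x : e (val x) = val x. Proof. exact: inN_U. Qed.

Let tr0 : X := exist inN o inN_o.
Let tr_opp x : X := exist inN _ (inN_d inN_o (NP x) inN_o).
Let tr_add x y : X := exist inN _ (inN_d (NP x) inN_o (NP y)).

Let doo x : d o o (val x) = val x. Proof. exact: dxxz. Qed.
Let dxoo x : d (val x) o o = val x. Proof. exact: dxzz. Qed.
Let dooo : d o o o = o. Proof. exact: dxxz. Qed.

(** This and the next laws, except the left unit law, come from the entropic law on a 3 by 3 array
    filled with [o] in suitable places. *)
Let tr_addC : commutative tr_add.
Proof.
move=> x y; apply: val_inj => /=.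
have := entropic inN_o inN_o (NP x) inN_o inN_o inN_o (NP y) inN_o inN_o.
by rewrite !doo !dxoo !dooo.
Qed.

Let tr_addA : associative tr_add.
Proof.
move=> x y z; apply: val_inj => /=.
have := entropic (NP x) inN_o inN_o inN_o inN_o inN_o (NP y) inN_o (NP z).
by rewrite doo dxoo !dooo.
Qed.

Let tr_add0 : left_id tr0 tr_add.
Proof. by move=> x; apply: val_inj; apply: doo. Qed.

Let tr_addN : left_inverse tr0 tr_opp tr_add.
Proof.
move=> x; rewrite tr_addC; apply: val_inj => /=.
have := entropic (NP x) inN_o inN_o inN_o inN_o inN_o inN_o (NP x) inN_o.
by rewrite dxoo !dooo doo dxxz.
Qed.

HB.instance Definition _ := GRing.isZmodule.Build trace_type
  tr_addA tr_addC tr_add0 tr_addN.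

Let val_affine x y (z : X) : val (x - y + z) = d (val x) (val y) (val z).
Proof.
have := entropic (NP x) inN_o inN_o inN_o inN_o (NP y) inN_o inN_o inN_o.
rewrite dxoo !dooo doo => E1.
have := entropic (NP x) (NP y) inN_o inN_o inN_o inN_o inN_o inN_o (NP z).
by rewrite !dxoo !dooo !doo E1.
Qed.

(** Commuting with [d], which is [x - y + z] in this group, is the same as being affine. *)
Let polW_affine W (p : (W -> T) -> T) (P : (W -> X) -> X) : polW op p ->
  (forall v, val (P v) = p (fun w => val (v w))) ->
  forall v v', P (fun w => v w + v' w) = P v - P (fun=> 0) + P v'.
Proof.
move=> pp Pp v v'; apply: val_inj; rewrite val_affine !Pp.
(* [pol_commutes_d] asks for values in U at every argument, whereas [p] is only known to take them
   on the trace; composing with [e] repairs this. *)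
have pep : polW op (fun v => e (p v)) by apply: pol1_comp pe pp.
have eP (u : W -> X) : e (p (fun w => val (u w))) = p (fun w => val (u w)).
  by rewrite -Pp NU.
rewrite -(eP v) -(eP v') -(eP (fun=> 0)) -(eP (fun w => v w + v' w)).
by rewrite -(pol_commutes_d pep) // => w; apply: inN_be2.
Qed.

(** Restrictions of unary polynomials that fix [o]: the ring of scalars of the trace. *)
Definition trace_scalars := [set f : {ffun X -> X} |
  `[< f 0 = 0 /\ exists2 r, pl1 r & forall x, val (f x) = r (val x) >]].
Local Notation R := trace_scalars.

Let inR (f : {ffun X -> X}) : reflect
  (f 0 = 0 /\ exists2 r, pl1 r & forall x, val (f x) = r (val x)) (f \in R).
Proof. by rewrite inE; apply: asboolP. Qed.

Let R_id : [ffun x => x] \in R.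
Proof.
apply/inR; split; first by rewrite ffunE.
by exists id; [exact: pol1_id|move=> x; rewrite ffunE].
Qed.

Let R_sub f g : f \in R -> g \in R -> [ffun x => f x - g x] \in R.
Proof.
move=> /inR [f0 [r pr fr]] /inR [g0 [s ps gs]]; apply/inR; split.
  by rewrite ffunE f0 g0 subrr.
exists (fun z => d (r z) (s z) o).
  by apply: (pol3_comp pd pr ps); apply: pol_cst.
by move=> x; rewrite ffunE -[f x - g x]addr0 val_affine fr gs.
Qed.

Let R_comp f g : f \in R -> g \in R -> [ffun x => f (g x)] \in R.
Proof.
move=> /inR [f0 [r pr fr]] /inR [g0 [s ps gs]]; apply/inR; split.
  by rewrite ffunE g0.
exists (fun z => r (s z)); first exact: pol1_comp.
by move=> x; rewrite ffunE fr gs.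
Qed.

Let R_add f : f \in R -> {morph f : x y / x + y}.
Proof.
move=> /inR [f0 [r pr fr]] x y.
have pw : polW op (fun v : unit -> T => r (v tt)).
  by apply: pol1_comp pr _; apply: pol_var; exists tt.
have := polW_affine pw (P := fun v => f (v tt)) _ (fun=> x) (fun=> y).
by rewrite f0 subr0; apply.
Qed.

(* A scalar that is not constant on the trace maps U onto U by minimality. *)
Let R_inj f : f \in R -> (forall x, f x = 0) \/ injective f.
Proof.
move=> /inR [f0 [r pr fr]].
have [f_triv|nf] := pselect (forall x, f x = 0); [by left|right].
have per : pl1 (fun z => e (r (e z))).
  by apply: pol1_comp pe (pol1_comp pr pe).
have er z : e (r (e (val z))) = val (f z) by rewrite NU -fr NU.
have onto : forall u, e u = u -> exists t, e (r (e t)) = u.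
  apply: (onto_U per) => [z|]; first exact: idem_e.
  apply: contrapT => nsep; apply: nf => x; apply: val_inj.
  apply: trivial_al; [exact: NU|exact: NU|].
  apply: contrapT => nal; apply: nsep; exists (val x), o; split.
    exact: inN_be2.
  by move: nal; rewrite -{1}er -f0 -er.
have /imset_injP inj : #|(fun z => e (r z)) @: U| == #|U|.
  rewrite eqn_leq leq_imset_card; apply: subset_leq_card.
  apply/subsetP => u /inU /onto [x <-]; apply: (imset_f (fun z => e (r z))).
  by apply/inU; apply: idem_e.
move=> x y fxy; apply: val_inj; apply: inj; [apply/inU/NU|apply/inU/NU|].
by rewrite -fr -fr fxy.
Qed.

Let X_nontrivial : exists x : X, x != 0.
Proof.
exists (exist inN v0 (inNP Uv0 bov0)); apply/eqP => /(congr1 val) /= E.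
exact: nov0.
Qed.

Let polW_scalar k' (p : ('I_k' -> T) -> T) (P : ('I_k' -> X) -> X) : polW op p ->
  (forall v, val (P v) = p (fun w => val (v w))) ->
  forall i, [ffun x => P (upd (fun=> 0) i x) - P (fun=> 0)] \in R.
Proof.
move=> pp Pp i; apply/inR; split.
  by rewrite ffunE upd_same subrr.
exists (fun z => d (p (upd (fun=> o) i z)) (val (P (fun=> 0))) o).
  apply: (pol3_comp pd); [|exact: pol_cst|exact: pol_cst].
  apply: (pol_comp (psi := fun z => upd (fun=> o) i z)) pp => h [w ->].
  rewrite /upd; case: eqP => _; [exact: pol1_id|exact: pol_cst].
move=> x; rewrite ffunE -[P _ - _]addr0 val_affine; congr (d _ _ _).
by rewrite Pp; congr (p _); apply/funext => w; rewrite /upd; case: eqP.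
Qed.

(** After subtracting its value at 0, [P] is additive, and a vector is the sum of its one-coordinate
    parts. *)
Let polW_sum k' (p : ('I_k' -> T) -> T) (P : ('I_k' -> X) -> X) : polW op p ->
  (forall v, val (P v) = p (fun w => val (v w))) ->
  forall v, P v = \sum_i (P (upd (fun=> 0) i (v i)) - P (fun=> 0)) + P (fun=> 0).
Proof.
move=> pp Pp v; pose Q (f : {ffun 'I_k' -> X}) := P f - P (fun=> 0).
have QD : {morph Q : f g / f + g}.
  move=> f g; rewrite /Q.
  have -> : (f + g : _ -> _) = fun w => f w + g w by apply/funext => w; rewrite ffunE.
  by rewrite (polW_affine pp Pp) -!addrA; congr (_ + _); rewrite [LHS]addrCA.
have Q0 : Q 0 = 0.
  by apply: (addrI (Q 0)); rewrite -QD !addr0.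
have Ev :
    \sum_i [ffun j => upd (fun=> 0) i (v i) j] = [ffun j => v j] :> {ffun 'I_k' -> X}.
  apply/ffunP => j; rewrite sum_ffunE ffunE (bigD1 j) //= ffunE /upd eqxx.
  rewrite big1 ?addr0 // => i nij; rewrite ffunE /upd eq_sym.
  by rewrite (negbTE nij).
have Qf w : Q [ffun j => w j] = P w - P (fun=> 0).
  by rewrite /Q; congr (P _ - _); apply/funext => j; rewrite ffunE.
rewrite -[LHS](subrK (P (fun=> 0))) -Qf -Ev (big_morph Q QD Q0).
by congr (_ + _); apply: eq_bigr => i _; rewrite Qf.
Qed.

Let linear_poly k' (f : 'I_k' -> {ffun X -> X}) (c : X) :
  (forall i, f i \in R) -> forall s : seq 'I_k', exists2 p, polW op p &
  forall v : 'I_k' -> X, p (fun w => val (v w)) = val (\sum_(i <- s) f i (v i) + c).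
Proof.
move=> Rf; elim=> [|i s [p pp IH]].
  by exists (fun=> val c) => [|v]; [exact: pol_cst|rewrite big_nil add0r].
have /inR [f0 [r pr fr]] := Rf i.
exists (fun v => d (r (v i)) o (p v)).
  apply: (pol3_comp pd) => //; last exact: pol_cst.
  by apply: pol1_comp pr _; apply: pol_var; exists i.
by move=> v; rewrite IH -fr big_cons -addrA.
Qed.

(** As [al] is trivial on U, the quotient of the trace by [al] is the trace itself, with coordinates
    from [scalar_coordinates]. Polynomials preserving it are affine by [polW_sum], and [linear_poly]
    realizes every affine map. *)
Lemma trace_induced_type2 : induced_type2 op al [set t | inN t].
Proof.
have [F [n [E [E_inj E_onto ED EZ Ef]]]] :=
  scalar_coordinates R_id R_sub R_comp R_add R_inj X_nontrivial.
have [ar_ _] := cal.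
have E0 : E 0 = 0 by apply: (addrI (E 0)); rewrite -ED !addr0.
have liftX k' (x : 'I_k' -> T) : (forall i, x i \in [set t | inN t]) ->
    exists v : 'I_k' -> X, x = fun i => val (v i).
  move=> Nx; have Nx' i : inN (x i) by have := Nx i; rewrite inE.
  by exists (fun i => exist inN _ (Nx' i)).
exists F, n, (fun v => val (E v)); split; [|split; [|split; [|split]]].
- by move=> v; rewrite inE; apply: NP.
- move=> x; rewrite inE => Nx; have [v Ev] := E_onto (exist inN x Nx).
  by exists v; rewrite Ev; apply: ar_.
- by move=> v w /trivial_al H; apply/E_inj/val_inj/H; apply: NU.
- move=> k' p /poly_polW pp Np.
  have NPv (v : 'I_k' -> X) : inN (p (fun w => val (v w))).
    by rewrite -[inN _]in_set; apply: Np => i; rewrite inE; apply: NP.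
  pose P v : X := exist inN _ (NPv v).
  have Pp v : val (P v) = p (fun w => val (v w)) by [].
  have /fin_all_exists [r Hr] : forall i, exists r, forall v,
      E (r *: v) = P (upd (fun=> 0) i (E v)) - P (fun=> 0).
    move=> i; have [r Hr] := Ef _ (polW_scalar pp Pp i).
    by exists r => v; rewrite Hr ffunE.
  have [c Ec] := E_onto (P (fun=> 0)).
  exists r, c => v; rewrite -Pp.
  have -> : P (fun i => E (v i)) = E (\sum_i r i *: v i + c); last exact: ar_.
  rewrite (polW_sum pp Pp) ED Ec (big_morph E ED E0); congr (_ + _).
  by apply: eq_bigr => i _; rewrite Hr.
- move=> k' r c.
  have /fin_all_exists2 [f Rf Hf] : forall i, exists2 f, f \in R &
      forall v, E (r i *: v) = f (E v) by move=> i; apply: EZ.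
  have [p pp Hp] := linear_poly (E c) Rf (index_enum 'I_k').
  exists p; split; first exact/poly_polW.
  split.
    by move=> x /liftX [v ->]; rewrite Hp inE; apply: NP.
  move=> v; rewrite (Hp (fun i => E (v i))).
  rewrite ED (big_morph E ED E0).
  by under [in X in _ X]eq_bigr do rewrite Hf; apply: ar_.
Qed.

End Trace.

Lemma U_type2_quotient : type2_quotient op al be.
Proof.
have [o [v [Uo [Uv [bov nov]]]]] :
    exists o v, e o = o /\ e v = v /\ be o v /\ o <> v.
  apply: contrapT => none; apply: nontriv_be => x y Ux Uy bxy.
  by apply: contrapT => nxy; apply: none; exists x, y.
exists U, [set t | inN o t]; split; first exact: U_minimal.
split; last exact: trace_induced_type2 bov nov.
split.
  exists o; split; first exact/inU.
  move=> t; rewrite inE; split=> [/andP [Ut /asboolP bt]|[/inU Ut bt]].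
    by split=> //; rewrite inE.
  by apply/andP; split; [apply/eqP|apply/asboolP].
have [br _] := cbe.
exists o, v; split; first by rewrite inE /inN Uo eqxx; apply/asboolP.
split; first by rewrite inE /inN Uv eqxx; apply/asboolP.
by move=> aov; apply: nov; apply: trivial_al.
Qed.

End Level.

Lemma U_type2_minimal_set : type2_minimal_set op U.
Proof.
have [k [nGk Gk1]] := exists_level.
have [al [be [cov tal nbe beG]]] := exists_quotient nGk.
exists al, be; split=> //; split; last exact: U_minimal cov tal nbe.
exact: (U_type2_quotient Gk1 cov tal nbe beG).
Qed.

End Type2.

Lemma no_sa_quotient_maltsev (I : Type) (ar : I -> nat) (T : finType)
    (op : forall i : I, ('I_(ar i) -> T) -> T) G K M m0 z0 :
  central_chain op G K -> subalgebra op M ->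
  (forall S, subalgebra op S -> (forall x, M x -> S x) ->
    (exists2 z, S z & ~ M z) -> forall x, S x) ->
  M m0 -> ~ M z0 -> ~ has_nontrivial_sa_quotient op ->
  exists (e : T -> T) (d : T -> T -> T -> T), let V x := e x = x in
  [/\ pol1 op M e, pol3 op all_of d, forall x y z, V (d x y z),
      (forall x z, V x -> V z -> d x x z = z) /\
      (forall x z, V x -> V z -> d x z z = x) &
      [/\ forall x, V (e x), exists x y, e x <> e y, exists x, ~ M (e x) &
          forall g o, pol1 op all_of g -> (forall x, V (g x)) -> V o ->
            inj_on V g \/ inj_on V (fun x => d x (g x) o)]].
Proof.
move=> chG Mop Mmax Mm0 nMz0 nsa.
have [e [pe idem nce mine]] := exists_min_idempotent chG Mop Mmax Mm0 nMz0.
have [F dep] : exists F, depends_on_both op M e F.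
  apply: contrapT => nodep; apply: nsa.
  apply: (no_dependence_sa chG Mop Mmax Mm0 nMz0 pe idem nce) => F dep.
  by apply: nodep; exists F.
have [H [pH HV Hl Hr]] := dependence_quasigroup chG Mop Mmax pe nce mine dep.
have [d [pd dV d1 d2]] := quasigroup_maltsev (pol_M_all pe) idem pH HV Hl Hr.
have [x0 [y0 nxy]] := nce.
exists e, d; split=> //; split=> //.
- by exists x0, y0 => E; apply: nxy; rewrite E; apply: theta_refl.
(* [theta] identifies all elements of [M], so a range inside [M] would make [e] constant modulo
   [theta]. *)
- apply: contrapT => nM; apply: nxy; apply: (theta_M chG Mop Mmax);
    by apply: contrapT => nMe; apply: nM; eexists; apply: nMe.
by move=> g o pg gV Vo; apply: (inj_or_difference_inj chG pe).
Qed.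

(** * Polynomials of powers *)

Section Spread.
Context {I : Type} {ar : I -> nat} {T : finType}.
Variable op : forall i : I, ('I_(ar i) -> T) -> T.
Variable n : nat.
Local Notation B := {ffun 'I_n -> T}.
Local Notation opB := (pow_op n op).

Lemma pol_coord Y Z (vs : (Y -> B) -> Prop) (vs' : (Z -> T) -> Prop) j psi f :
  (forall h, vs h -> exists2 h', vs' h' & forall y, h y j = h' (psi y)) ->
  pol opB all_of vs f ->
  exists2 f', pol op all_of vs' f' & forall y, f y j = f' (psi y).
Proof.
move=> hv; elim=> {f} [f [/hv [h' vh' fh']|[c _ ->]]|i F _ /fin_all_exists2 [H pH FH]].
- by exists h' => //; apply: pol_var.
- by exists (fun=> c j) => //; apply: pol_cst.
exists (fun z => op (fun l => H l z)); first exact: (gen_op (F := H)).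
by move=> y; rewrite ffunE; congr (op _); apply/funext => l; apply: FH.
Qed.

Lemma pol3_coord d j : pol3 opB all_of d -> exists2 d', pol3 op all_of d' &
  forall x y z, d x y z j = d' (x j) (y j) (z j).
Proof.
move=> pd.
have hv (h : B * B * B -> B) :
    [\/ h = fun p => p.1.1, h = fun p => p.1.2 | h = snd] ->
    exists2 h' : T * T * T -> T,
      [\/ h' = fun p => p.1.1, h' = fun p => p.1.2 | h' = snd] &
      forall y, h y j = h' (y.1.1 j, y.1.2 j, y.2 j).
  case=> ->.
  - by exists (fun p => p.1.1) => //; apply: Or31.
  - by exists (fun p => p.1.2) => //; apply: Or32.
  - by exists snd => //; apply: Or33.
have [f' pf' df'] := pol_coord
  (psi := fun p : B * B * B => (p.1.1 j, p.1.2 j, p.2 j)) hv pd.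
exists (fun x y z => f' (x, y, z)); last by move=> x y z; apply: (df' (x, y, z)).
have f'E : (fun p : T * T * T => f' (p.1.1, p.1.2, p.2)) = f'.
  by apply/funext => -[[x y] z].
by rewrite /pol3 f'E.
Qed.

(** A parameter in the power is a tuple whose [j]-th entry serves coordinate [j]; the coordinate
    maps thus differ only in parameters. *)
Lemma pol1_coords M f : pol1 opB M f -> exists2 E, twin op E &
  forall b j, f b j = E j (b j).
Proof.
elim=> {f} [f [->|[c _ ->]]|i F _ /fin_all_exists2 [H tH FH]].
- by exists (fun _ x => x) => //; apply: twin_id.
- exists (fun j _ => c j) => //; apply: gen_base; left.
  by exists (fun j => c j).
exists (fun j x => op (fun l => H l j x)).
  exact: (gen_op (F := fun l p => H l p.1 p.2)).
by move=> b j; rewrite ffunE; congr (op _); apply/funext => l; apply: FH.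
Qed.

Lemma pol1_diag f : pol1 op all_of f ->
  pol1 opB all_of (fun b => [ffun j => f (b j)]).
Proof.
elim=> {f} [f [->|[c _ ->]]|i F _ IH].
- rewrite /pol1 (_ : (fun b => _) = id); first exact: pol1_id.
  by apply/funext => b; apply/ffunP => j; rewrite ffunE.
- exact: (@pol_cst _ _ _ opB all_of _ _ [ffun=> c]).
have -> : (fun b : B => [ffun j => op (fun l => F l (b j))]) =
    fun b => opB i (fun l => [ffun j => F l (b j)]).
  apply/funext => b; apply/ffunP => j; rewrite !ffunE; congr (op _).
  by apply/funext => l; rewrite ffunE.
exact: (@gen_op _ _ _ opB _ _ i (fun l (b : B) => [ffun j => F l (b j)])).
Qed.

Definition type2_tuple (b : B) :=
  exists2 W, type2_minimal_set op W & forall j, b j \in W.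

Definition spread_gen (h : 'I_n -> T) :=
  (exists c, h = fun=> c) \/ (exists2 b, type2_tuple b & h = b).

Lemma spread_gen_poly h : gen op spread_gen h ->
  exists k (p : ('I_k -> T) -> T) (b : 'I_k -> B),
    [/\ polW op p, forall i, type2_tuple (b i) & forall j, h j = p (b^~ j)].
Proof.
(* One variable is provided for each type 2 tuple; the power is finite, so these form a finite
   type. *)
pose W := {b | `[< type2_tuple b >]}.
move=> gh; suff [q pq hq] : exists2 q : (W -> T) -> T, polW op q &
    forall j, h j = q (fun w => val w j).
  exists #|{: W}|, (fun x => q (fun w => x (enum_rank w))), (fun i => val (enum_val i)).
  split.
  - apply: (pol_comp (psi := fun x w => x (enum_rank w))) pq => f [w ->].
    by apply: pol_var; exists (enum_rank w).
  - by move=> i; apply/asboolP/(valP (enum_val i)).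
  - move=> j; rewrite hq; congr (q _); apply/funext => w.
    by rewrite enum_rankK.
elim: gh => {h} [_ [[c ->]|[b tb ->]]|i F _ /fin_all_exists2 [H pH FH]].
- by exists (fun=> c) => //; apply: pol_cst.
- pose w : W := exist _ b (asboolT tb).
  by exists (@^~ w) => //; apply: pol_var; exists w.
exists (fun x => op (fun l => H l x)); first exact: (gen_op (F := H)).
by move=> j; congr (op _); apply/funext => l; apply: FH.
Qed.

End Spread.

Lemma maximal_subalgebra (I : Type) (ar : I -> nat) (T : finType)
    (op : forall i : I, ('I_(ar i) -> T) -> T) (S : T -> Prop) z :
  subalgebra op S -> ~ S z ->
  exists M, [/\ subalgebra op M, forall x, S x -> M x, exists z, ~ M z &
    forall S', subalgebra op S' -> (forall x, M x -> S' x) ->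
      (exists2 z, S' z & ~ M z) -> forall x, S' x].
Proof.
move=> Sop nSz.
pose P M := [/\ subalgebra op M, forall x, S x -> M x & exists z, ~ M z].
have [M [Mop SM nM] maxM] : exists2 M, P M &
    forall M', P M' -> #|[set x | `[< M' x >]]| <= #|[set x | `[< M x >]]|.
  apply: (@max_exists _ _ _ #|T|) => [M _|]; first exact: max_card.
  by exists S; split=> //; exists z.
exists M; split=> // S' S'op MS' [y S'y nMy] x.
apply: contrapT => nS'x.
have : #|[set x | `[< S' x >]]| <= #|[set x | `[< M x >]]|.
  by apply: maxM; split=> // [u Su|]; [apply/MS'/SM|exists x].
apply/negP; rewrite -ltnNge; apply: proper_card; apply/properP; split.
  by apply/subsetP => u; rewrite !inE => /asboolP Mu; apply/asboolP/MS'.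
by exists y; rewrite inE; [apply/asboolP|apply/negP => /asboolP].
Qed.

(** * Coordinates of the idempotent on the power *)

Section Coordinates.
Context {I : Type} {ar : I -> nat} {T : finType}.
Variable op : forall i : I, ('I_(ar i) -> T) -> T.
Variables (G : nat -> T -> T -> Prop) (K n : nat).
Hypothesis chainG : central_chain op G K.
Local Notation B := {ffun 'I_n -> T}.
Local Notation opB := (pow_op n op).
Variables (e : B -> B) (E : 'I_n -> T -> T).
Hypotheses (tE : twin op E) (eE : forall b j, e b j = E j (b j)).
Hypothesis idem_e : forall b, e (e b) = e b.

Let idem_E j t : E j (E j t) = E j t.
Proof. by have /ffunP /(_ j) := idem_e [ffun=> t]; rewrite !eE ffunE. Qed.

(* The coordinate retracts are twins, so by [twin_inj] their ranges have the
   same size and each of them maps the range of any other onto its own. *)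
Lemma retract_onto j0 b : exists2 c : B, forall j, c j \in U (E j0) & e c = e b.
Proof.
have E_inj i j : inj_on (fun t => E i t = t) (E j).
  apply: (twin_inj (z := i) chainG tE) => [t _|x y <- <-]; first exact: idem_E.
  by rewrite !idem_E.
have im_sub i j : E j @: U (E i) \subset U (E j).
  by apply/subsetP => _ /imsetP [t _ ->]; rewrite inE idem_E.
have card_im i j : #|E j @: U (E i)| = #|U (E i)|.
  by apply: card_in_imset => x y; rewrite !inE => /eqP Ex /eqP Ey; apply: E_inj Ex Ey.
have onto j : E j @: U (E j0) = U (E j).
  apply/eqP; rewrite eqEcard im_sub card_im -(card_im j j0).
  by rewrite subset_leq_card ?im_sub.
have /fin_all_exists2 [c Uc Ec] :
    forall j, exists2 t, t \in U (E j0) & e b j = E j t.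
  move=> j; apply/imsetP; rewrite onto inE eE; apply/eqP/idem_E.
exists [ffun j => c j]; first by move=> j; rewrite ffunE.
by apply/ffunP => j; rewrite eE ffunE Ec.
Qed.

Variable d : B -> B -> B -> B.
Hypotheses (pd : pol3 opB all_of d) (dV : forall x y z, e (d x y z) = d x y z).
Hypothesis dxxz : forall x z, e x = x -> e z = z -> d x x z = z.
Hypothesis dxzz : forall x z, e x = x -> e z = z -> d x z z = x.
Hypothesis pe : pol1 opB all_of e.
Hypothesis inj_alt : forall g o, pol1 opB all_of g ->
  (forall x, e (g x) = g x) -> e o = o ->
  inj_on (fun x => e x = x) g \/ inj_on (fun x => e x = x) (fun x => d x (g x) o).

(** Let [f] act diagonally and follow it by [e], giving [g]. If [g] is injective on the range of
    [e], it is onto it, so every element of U at [j0] is a value of the idempotent [f]. The other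
    alternative in [inj_alt] fails on two tuples that differ only at [j0]. *)
Lemma coord_e_minimal j0 f : pol1 op all_of f ->
  (forall x, E j0 (f x) = f x) -> (forall x, f (f x) = f x) ->
  (exists x y, f x <> f y) -> forall u, E j0 u = u -> f u = u.
Proof.
move=> pf Ef ff [x [y nxy]] u Eu.
pose g (b : B) := e [ffun j => f (b j)].
have pg : pol1 opB all_of g := pol1_comp pe (pol1_diag n pf).
have gV b : e (g b) = g b by apply: idem_e.
have gE b j : g b j = E j (f (b j)) by rewrite eE ffunE.
pose o := e [ffun=> f x].
have oj0 : o j0 = f x by rewrite /o eE ffunE Ef.
have [g_inj|d_inj] := inj_alt pg gV (idem_e [ffun=> f x]).
  have [b _ /ffunP /(_ j0)] := inj_on_surj (fun b _ => gV b) g_inj (idem_e [ffun=> u]).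
  by rewrite gE Ef eE ffunE Eu => <-.
(* At [j0] the tuples [o] and [o'] carry distinct fixed points [f x] and [f y] of [f], so there [d]
   receives two equal first arguments and returns [f x] for both; elsewhere the tuples agree. *)
pose o' : B := [ffun j => if j == j0 then f y else o j].
have Vo : e o = o := idem_e _.
have Vo' : e o' = o'.
  apply/ffunP => j; rewrite eE ffunE; case: eqP => [->|_]; first exact: Ef.
  by rewrite -eE Vo.
case: nxy; rewrite -oj0 (d_inj o o' Vo Vo') ?ffunE ?eqxx //.
apply/ffunP => j; have [dj _ dE] := pol3_coord j pd.
have [jj|njj] := eqVneq j j0; last first.
  have E' : o' j = o j by rewrite ffunE (negbTE njj).
  by rewrite !dE !gE E'.
have go : g o j0 = o j0 by rewrite gE Ef oj0 ff.
have go' : g o' j0 = o' j0 by rewrite gE Ef ffunE eqxx ff.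
rewrite jj in dE *.
by rewrite !dE go go' -!dE !dxxz.
Qed.

Lemma coord_type2_minimal j0 : (exists x y, E j0 x <> E j0 y) ->
  type2_minimal_set op (U (E j0)).
Proof.
move=> ncE; have [dj pdj dE] := pol3_coord j0 pd.
have pE : pol1 op all_of (E j0) by apply: twin_at.
have lift x : E j0 x = x -> exists2 b, e b = b & b j0 = x.
  by move=> Ex; exists (e [ffun=> x]); [exact: idem_e|rewrite eE ffunE].
apply: (U_type2_minimal_set chainG (d := dj)) => //.
- move=> x y z; have /ffunP /(_ j0) := dV [ffun=> x] [ffun=> y] [ffun=> z].
  by rewrite eE dE !ffunE.
- by move=> _ _ /lift [x Vx <-] /lift [z Vz <-]; rewrite -dE dxxz.
- by move=> _ _ /lift [x Vx <-] /lift [z Vz <-]; rewrite -dE dxzz.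
- exact: coord_e_minimal.
Qed.

End Coordinates.

Theorem theorem6p3 (I : Type) (ar : I -> nat) (T : finType)
  (op : forall i : I, ('I_(ar i) -> T) -> T) :
  (0 < #|T|)%N ->
  left_nilpotent op ->
  ~ has_nontrivial_sa_quotient (pow_op #|T| op) ->
  spread_of_type2_minimal_sets op.
Proof.
move=> /card_gt0P [t0 _] /lcs_chain [K chA] nsa.
pose S (b : {ffun 'I_#|T| -> T}) := gen op (spread_gen op (n := #|T|)) b.
(* If the enumerating tuple is generated, its coordinate at [enum_rank y] exhibits [y] as a value of
   the polynomial on the type 2 minimal sets. *)
have [S_id|nS_id] := pselect (S [ffun j => enum_val j]).
  have [k [p [b [pp tb hp]]]] := spread_gen_poly S_id.
  have /fin_all_exists2 [W tW bW] i := tb i.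
  exists k, p, W; split; first exact/poly_polW.
  split=> // y; exists (b^~ (enum_rank y)); split; first by move=> i; apply: bW.
  by rewrite -hp ffunE enum_rankK.
have Sop : subalgebra (pow_op #|T| op) S.
  move=> i a Sa; have opE : (pow_op #|T| op i a : _ -> _) = fun j => op i (a^~ j).
    by apply/funext => j; rewrite ffunE.
  by rewrite /S opE; apply: (gen_op (F := fun l j => a l j)).
have [M [Mop SM [z nMz] Mmax]] := maximal_subalgebra Sop nS_id.
have Mt0 : M [ffun=> t0].
  apply/SM/gen_base; left; exists t0; apply/funext => j; exact: ffunE.
have chB := chain_pow #|T| chA.
have [e [d [pe pd dV [dxxz dxzz] [idem [x [y nxy]] [c nMc] alt]]]] :=
  no_sa_quotient_maltsev chB Mop Mmax Mt0 nMz nsa.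
have [E tE eE] := pol1_coords pe.
have [j0 nE] : exists j, E j (x j) <> E j (y j).
  apply: contrapT => none; apply: nxy; apply/ffunP => j; rewrite !eE.
  by apply: contrapT => nE; apply: none; exists j.
have type2U : type2_minimal_set op (U (E j0)).
  apply: (coord_type2_minimal chA tE eE idem pd dV dxxz dxzz (pol_M_all pe) alt).
  by exists (x j0), (y j0).
(* The tuple [b] is a generator of [S], so it lies in [M], and the [M]-polynomial [e] sends it to
   [e c], which was chosen outside [M]. *)
have [b bU eb] := retract_onto chA tE eE idem j0 c.
case: nMc; rewrite -eb; apply: (pol1_M Mop pe); apply/SM/gen_base; right.
by exists b => //; exists (U (E j0)).
Qed.
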